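(* Let $\mathbf{X}\in\mathbb{R}^{d\times d}$ be symmetric with $\mathbf{X}\succeq0$, $\lambda_1(\mathbf{X})\le1$, and eigengap $\delta=\lambda_1(\mathbf{X})-\lambda_2(\mathbf{X})>0$, and let $\mathbf{u}_1$ be its unit leading eigenvector. Suppose that $\hat\delta\in[\delta/2,3\delta/4]$. Fix $\epsilon\in(0,1)$ and $p>0$. Let $m_1\ge T^{PM}_{crude}(1/8,p)$ and $m_2\ge T^{PM}_{acc}(3,\epsilon/2,p)$ be integers, and suppose that $\tilde\epsilon>0$ satisfies $$\tilde\epsilon\le\min\left\{\frac1{16}\left(\frac{\hat\delta}{8}\right)^{m_1+1},\ \frac{\epsilon}{4}\left(\frac{\hat\delta}{8}\right)^{m_2+1}\right\}.$$ Then, with probability at least $1-p$, the output of the algorithm Leading Eigenvector via Convex Optimization (described in the context), the unit vector $\mathbf{w}_f$, satisfies $(\mathbf{w}_f^{\top}\mathbf{u}_1)^2\ge1-\epsilon$, and, when $m_1=T^{PM}_{crude}(1/8,p)$ and $m_2=T^{PM}_{acc}(3,\epsilon/2,p)$, the total number of calls to the convex optimization oracle $\mathcal{A}$ is $$O\left(\log(d/p)\log(\delta^{-1})+\log\left(\frac{d}{p\epsilon}\right)\right).$$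
   Context: Notation: $T^{PM}_{crude}(\epsilon,p)=\left\lceil\frac1\epsilon\ln\left(\frac{18d}{p^2\epsilon}\right)\right\rceil$ and $T^{PM}_{acc}(\kappa,\epsilon,p)=\left\lceil\frac{\kappa}{2}\ln\left(\frac{9d}{p^2\epsilon}\right)\right\rceil$. $\lambda_1(\cdot)\ge\lambda_2(\cdot)\ge\dots$ are eigenvalues in descending order. Oracle $\mathcal{A}$: a procedure which, given $\lambda>\lambda_1(\mathbf{X})$, a vector $\mathbf{w}$ and a tolerance $\tilde\epsilon$, returns an approximate minimizer of $F_{\mathbf{w},\lambda}(\mathbf{z})=\frac12\mathbf{z}^{\top}(\lambda\mathbf{I}-\mathbf{X})\mathbf{z}-\mathbf{w}^{\top}\mathbf{z}$, namely a vector $\mathbf{z}$ with $\|\mathbf{z}-(\lambda\mathbf{I}-\mathbf{X})^{-1}\mathbf{w}\|\le\tilde\epsilon$. Algorithm (Leading Eigenvector via Convex Optimization), with inputs $\mathbf{X},\hat\delta,\epsilon,p$ and parameters $m_1,m_2,\tilde\epsilon$: 1. Set $\lambda_{(0)}=1+\hat\delta$; let $\hat{\mathbf{w}}_0$ be a uniformly random unit vector in $\mathbb{R}^d$; $s=0$. 2. Repeat: $s\leftarrow s+1$; $\mathbf{M}_s=\lambda_{(s-1)}\mathbf{I}-\mathbf{X}$; for $t=1,\dots,m_1$ use $\mathcal{A}$ to find $\hat{\mathbf{w}}_t$ with $\|\hat{\mathbf{w}}_t-\mathbf{M}_s^{-1}\hat{\mathbf{w}}_{t-1}\|\le\tilde\epsilon$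 (always starting from the same $\hat{\mathbf{w}}_0$); $\mathbf{w}_s=\hat{\mathbf{w}}_{m_1}/\|\hat{\mathbf{w}}_{m_1}\|$; use $\mathcal{A}$ to find $\mathbf{v}_s$ with $\|\mathbf{v}_s-\mathbf{M}_s^{-1}\mathbf{w}_s\|\le\tilde\epsilon$; $\Delta_s=\frac12\cdot\frac1{\mathbf{w}_s^{\top}\mathbf{v}_s-\tilde\epsilon}$; $\lambda_{(s)}=\lambda_{(s-1)}-\frac{\Delta_s}{2}$; until $\Delta_s\le\hat\delta$. 3. Set $\lambda_{(f)}=\lambda_{(s)}$, $\mathbf{M}_f=\lambda_{(f)}\mathbf{I}-\mathbf{X}$. For $t=1,\dots,m_2$ use $\mathcal{A}$ to find $\hat{\mathbf{w}}_t$ with $\|\hat{\mathbf{w}}_t-\mathbf{M}_f^{-1}\hat{\mathbf{w}}_{t-1}\|\le\tilde\epsilon$ (starting from the same $\hat{\mathbf{w}}_0$). 4. Return $\mathbf{w}_f=\hat{\mathbf{w}}_{m_2}/\|\hat{\mathbf{w}}_{m_2}\|$. *)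

(* Defs.v *)
From HB Require Import structures.
From mathcomp Require Import all_boot all_order all_algebra.
From mathcomp Require Import all_classical all_reals all_analysis.

Set Implicit Arguments.
Unset Strict Implicit.
Unset Printing Implicit Defensive.

Import Order.TTheory GRing.Theory Num.Theory.
Import numFieldNormedType.Exports.

Local Open Scope classical_set_scope.
Local Open Scope ring_scope.

Section LinearAlgebra.
Variables (R : realType) (d : nat).
Implicit Types (X : 'M[R]_d) (u v w : 'cV[R]_d).

Definition dotv u v : R := \sum_(i < d) u i ord0 * v i ord0.

(* The library norm [`|v|] on matrices is the sup norm. *)
Definition norm2 v : R := Num.sqrt (dotv v v).

Definition normalize v : 'cV[R]_d := (norm2 v)^-1 *: v.

Definition psd X : Prop := forall v, 0 <= dotv v (X *m v).

(* Eigenvalues with multiplicity, in descending order.  Such a list is unique,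
   and it exists for symmetric [X]; otherwise [xget] may return its default. *)
Definition eigenvalues X : seq R :=
  xget [::] [set s | sorted >=%R s /\
                     char_poly X = \prod_(a <- s) ('X - a%:P)].

(* 1-based: [lambda_ X 1 >= lambda_ X 2 >= ...]; meaningful for 1 <= k <= d. *)
Definition lambda_ X (k : nat) : R := (eigenvalues X)`_k.-1.

Definition eigengap X : R := lambda_ X 1 - lambda_ X 2.

Definition unit_leading_eigenvector X u : Prop :=
  norm2 u = 1 /\ X *m u = lambda_ X 1 *: u.

(* The uniform law on the unit sphere is the rotation-invariant Borel
   probability measure on it. *)
Definition uniform_unit_vector (d0 : measure_display) (Omega : measurableType d0)
    (P : probability Omega R) (W : Omega -> 'cV[R]_d) : Prop :=
  [/\ forall B : set 'cV[R]_d, <<s @open 'cV[R]_d >> B -> measurable (W @^-1` B),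
      forall omega, norm2 (W omega) = 1 &
      forall (Q : 'M[R]_d) (B : set 'cV[R]_d), Q^T *m Q = 1%:M ->
        <<s @open 'cV[R]_d >> B ->
        P [set omega | B (Q *m W omega)] = P [set omega | B (W omega)]].

End LinearAlgebra.

Section PowerMethodCounts.
Variables (R : realType) (d : nat).

Definition T_crude (eps p : R) : int :=
  Num.ceil (eps^-1 * ln (18 * d%:R / (p ^+ 2 * eps))).

Definition T_acc (kappa eps p : R) : int :=
  Num.ceil (kappa / 2 * ln (9 * d%:R / (p ^+ 2 * eps))).

End PowerMethodCounts.

Section Algorithm.
Variables (R : realType) (d : nat).

(* [A k lam w tol] is the answer to the k-th call of the execution, made on the
   query (lam, w, tol).  The call number lets the answers of a stateful or
   randomized procedure vary from call to call, even on equal queries. *)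
Definition oracle := nat -> R -> 'cV[R]_d -> R -> 'cV[R]_d.

Definition valid_oracle (X : 'M[R]_d) (A : oracle) : Prop :=
  forall k lam w tol, lambda_ X 1 < lam -> 0 < tol ->
    norm2 (A k lam w tol - invmx (lam%:M - X) *m w) <= tol.

Variables (A : oracle) (hdelta : R) (m1 m2 : nat) (tol : R) (w0 : 'cV[R]_d).

(* [k] is the number of oracle calls made so far; the updated number is
   returned. *)
Fixpoint inverse_power (m : nat) (lam : R) (k : nat) : 'cV[R]_d * nat :=
  if m is m'.+1 then
    let: (w, k') := inverse_power m' lam k in (A k' lam w tol, k'.+1)
  else (w0, k).

(* One pass of the repeat loop, from (lambda_(s-1), calls) to
   (Delta_s, lambda_(s), calls). *)
Definition repeat_body (lam : R) (k : nat) : R * R * nat :=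
  let: (hw, k1) := inverse_power m1 lam k in
  let w := normalize hw in
  let v := A k1 lam w tol in
  let Delta := 2^-1 * (dotv w v - tol)^-1 in
  (Delta, lam - Delta / 2, k1.+1).

(* [repeat_loop lam k lamf kf]: entered with (lam, k), the repeat loop
   terminates with (lamf, kf). *)
Inductive repeat_loop (lam : R) (k : nat) : R -> nat -> Prop :=
| RepeatStop Delta lam' k' :
    repeat_body lam k = (Delta, lam', k') -> Delta <= hdelta ->
    repeat_loop lam k lam' k'
| RepeatAgain Delta lam' k' lamf kf :
    repeat_body lam k = (Delta, lam', k') -> hdelta < Delta ->
    repeat_loop lam' k' lamf kf ->
    repeat_loop lam k lamf kf.

(* The algorithm terminates and returns [wf] after [N] oracle calls.  The
   execution is deterministic once [A] and [w0] are fixed, so there is at most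
   one such pair. *)
Definition algorithm_returns (wf : 'cV[R]_d) (N : nat) : Prop :=
  exists lamf kf, repeat_loop (1 + hdelta) 0%N lamf kf /\
    exists hw, inverse_power m2 lamf kf = (hw, N) /\ wf = normalize hw.

End Algorithm.

(* Main.v *)
Require Import Defs.
From HB Require Import structures.
From mathcomp Require Import all_boot all_order all_algebra.
From mathcomp Require Import all_classical all_reals all_analysis.
From mathcomp Require Import measurable_realfun.
From mathcomp Require Import ring lra.

Set Implicit Arguments.
Unset Strict Implicit.
Unset Printing Implicit Defensive.

Import Order.TTheory GRing.Theory Num.Theory.
Import numFieldNormedType.Exports.

Local Open Scope classical_set_scope.
Local Open Scope ring_scope.

(** The proof separates the random start vector from a deterministic analysis
    of the iterations.

    Start vector.  Let [x] be the coordinate of the uniform unit vector along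
    the leading eigenvector.  One needs [`|x| >= p / (3 * sqrt d)] with
    probability at least [1 - p], knowing only that the law is invariant under
    orthogonal maps.  By invariance all coordinates along unit vectors have the
    same law, in particular second moment [1 / d] (coordinate_second_moment).
    Rotating [x] by a small angle towards an orthogonal coordinate [y] turns it
    into [c * x + s * y] and [c * x - s * y], which have the same law as [x].
    So, for the Huber function [h], the second difference
    [h (c * x + s * y) + h (c * x - s * y) - 2 * h x] has expectation zero.  Up
    to a loss of at most a multiple of [(1 - c) * `|x|], it is nonnegative, and
    at least [s ^+ 2 * y ^+ 2] where [`|x|] is small.  As [1 - c] is of order
    [s ^+ 2], summing over the directions orthogonal to the leading eigenvector
    bounds the probability that [`|x|] is small (rotation_bound,
    sphere_anticoncentration).  This is a discrete form of the Stein identity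
    of the marginal of the sphere, and it avoids any computation with the
    density of that marginal.

    Iterations.  Write [g = lam - lambda_ X 1].  The matrix
    [g *: invmx (lam%:M - X)] is a symmetric contraction that fixes the leading
    eigenvector and contracts its orthogonal complement by
    [g / (g + eigengap X)] (shifted_inverse_step).  Since [g <= 1], the oracle
    errors, scaled in the same way, only add up (inverse_power_error), and the
    prescribed tolerance makes their sum negligible against the initial overlap
    (noise_le).  The crude phase needs a Rayleigh quotient within a constant
    factor of the optimum even when [g] is much larger than the gap; this
    follows from the log-convexity of the moments of the start vector
    (power_rayleigh, crude_estimate).  Hence [Delta] lies between [g / 2] and
    [2 / 3 * g], and a pass shrinks [g] by a factor between [2 / 3] and [3 / 4]
    (repeat_bodyP).  The loop therefore stops after [O(ln delta^-1)] passes
    with [g] comparable to the gap (repeat_loop_terminates), and then the final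
    iterations converge at a constant rate (accurate_estimate). *)

(** * The Euclidean inner product and norm *)

Section DotProduct.
Variables (R : realType).
Implicit Types (d : nat).

Lemma dotvE d (u v : 'cV[R]_d) : dotv u v = (u^T *m v) ord0 ord0.
Proof. by rewrite /dotv mxE; apply: eq_bigr => i _; rewrite mxE. Qed.

Lemma dotvC d (u v : 'cV[R]_d) : dotv u v = dotv v u.
Proof. by apply: eq_bigr => i _; rewrite mulrC. Qed.

Lemma dotvDl d (u v w : 'cV[R]_d) : dotv (u + v) w = dotv u w + dotv v w.
Proof. by rewrite -big_split; apply: eq_bigr => i _; rewrite mxE mulrDl. Qed.

Lemma dotvZl d (a : R) (u v : 'cV[R]_d) : dotv (a *: u) v = a * dotv u v.
Proof. by rewrite mulr_sumr; apply: eq_bigr => i _; rewrite mxE mulrA. Qed.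

Lemma dotvNl d (u v : 'cV[R]_d) : dotv (- u) v = - dotv u v.
Proof. by rewrite -scaleN1r dotvZl mulN1r. Qed.

Lemma dotvBl d (u v w : 'cV[R]_d) : dotv (u - v) w = dotv u w - dotv v w.
Proof. by rewrite dotvDl dotvNl. Qed.

Lemma dotvDr d (u v w : 'cV[R]_d) : dotv w (u + v) = dotv w u + dotv w v.
Proof. by rewrite dotvC dotvDl !(dotvC w). Qed.

Lemma dotvZr d (a : R) (u v : 'cV[R]_d) : dotv u (a *: v) = a * dotv u v.
Proof. by rewrite dotvC dotvZl dotvC. Qed.

Lemma dotvNr d (u v : 'cV[R]_d) : dotv u (- v) = - dotv u v.
Proof. by rewrite dotvC dotvNl dotvC. Qed.

Lemma dotvBr d (u v w : 'cV[R]_d) : dotv w (u - v) = dotv w u - dotv w v.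
Proof. by rewrite dotvC dotvBl !(dotvC w). Qed.

Definition dotv_lin := (dotvDl, dotvDr, dotvBl, dotvBr, dotvNl, dotvNr,
                        dotvZl, dotvZr).

Lemma dotv_mull d n (A : 'M[R]_(n, d)) (u : 'cV[R]_n) (v : 'cV[R]_d) :
  dotv (A^T *m u) v = dotv u (A *m v).
Proof. by rewrite !dotvE trmx_mul trmxK mulmxA. Qed.

Lemma dotv_ge0 d (u : 'cV[R]_d) : 0 <= dotv u u.
Proof. by apply: sumr_ge0 => i _; rewrite -expr2 sqr_ge0. Qed.

Lemma dotv_eq0 d (u : 'cV[R]_d) : dotv u u = 0 -> u = 0.
Proof.
move=> /eqP; rewrite psumr_eq0; last by move=> i _; rewrite -expr2 sqr_ge0.
move=> /allP u0; apply/matrixP => i j; rewrite ord1 mxE.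
have := u0 i (mem_index_enum i).
by rewrite /= -expr2 sqrf_eq0 => /eqP.
Qed.

Lemma dotv_isometry d (Q : 'M[R]_d) (u v : 'cV[R]_d) : Q^T *m Q = 1%:M ->
  dotv (Q *m u) (Q *m v) = dotv u v.
Proof. by move=> QQ; rewrite -dotv_mull mulmxA QQ mul1mx. Qed.

(** The Cauchy-Schwarz inequality is needed in the degenerate inner products
    given by a positive semidefinite matrix: a null vector [v] is handled by
    letting the quadratic polynomial degenerate to a linear one. *)
Lemma psd_CauchySchwarz d (S : 'M[R]_d) (u v : 'cV[R]_d) :
  S^T = S -> psd S ->
  dotv u (S *m v) ^+ 2 <= dotv u (S *m u) * dotv v (S *m v).
Proof.
move=> Ssym Spsd.
have sym w1 w2 : dotv w1 (S *m w2) = dotv w2 (S *m w1).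
  by rewrite -dotv_mull Ssym dotvC.
have q s t : 0 <= s ^+ 2 * dotv u (S *m u) - 2 * s * t * dotv u (S *m v)
                  + t ^+ 2 * dotv v (S *m v).
  have := Spsd (s *: u - t *: v).
  rewrite mulmxBr -!scalemxAr !dotv_lin (sym v u) => h.
  by rewrite (le_trans h)// le_eqVlt; apply/orP; left; apply/eqP; ring.
set a := dotv u (S *m u) in q *; set b := dotv u (S *m v) in q *.
set c := dotv v (S *m v) in q *.
have a0 : 0 <= a := Spsd u.
have : 0 <= c := Spsd v.
rewrite le_eqVlt => /predU1P[|c_gt0].
  move=> c0; rewrite -c0 mulr0 in q *.
  have [->|b_neq0] := eqVneq b 0; first by rewrite expr0n.
  have := q 1 ((a + 1) / (2 * b)).
  have -> : 1 ^+ 2 * a - 2 * 1 * ((a + 1) / (2 * b)) * b +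
            ((a + 1) / (2 * b)) ^+ 2 * 0 = -1 by field.
  by rewrite lerNr oppr0 ler10.
have := q c b.
have -> : c ^+ 2 * a - 2 * c * b * b + b ^+ 2 * c = c * (a * c - b ^+ 2) by ring.
by rewrite pmulr_rge0// subr_ge0.
Qed.

Lemma dotv_CauchySchwarz d (u v : 'cV[R]_d) :
  dotv u v ^+ 2 <= dotv u u * dotv v v.
Proof.
have := @psd_CauchySchwarz _ 1%:M u v (trmx1 _ _).
by rewrite !mul1mx; apply=> w; rewrite mul1mx dotv_ge0.
Qed.

Lemma norm2_ge0 d (u : 'cV[R]_d) : 0 <= norm2 u.
Proof. exact: sqrtr_ge0. Qed.

Lemma norm2_sqr d (u : 'cV[R]_d) : norm2 u ^+ 2 = dotv u u.
Proof. by rewrite sqr_sqrtr ?dotv_ge0. Qed.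

Lemma norm2_eq0 d (u : 'cV[R]_d) : norm2 u = 0 -> u = 0.
Proof. by move=> u0; apply: dotv_eq0; rewrite -norm2_sqr u0 expr0n. Qed.

Lemma norm2Z d (a : R) (u : 'cV[R]_d) : norm2 (a *: u) = `|a| * norm2 u.
Proof.
rewrite /norm2 dotvZl dotvZr mulrA -expr2 sqrtrM ?sqr_ge0//.
by rewrite sqrtr_sqr.
Qed.

Lemma norm20 d : norm2 (0 : 'cV[R]_d) = 0.
Proof. by rewrite -(scale0r 0) norm2Z normr0 mul0r. Qed.

Lemma norm2N d (u : 'cV[R]_d) : norm2 (- u) = norm2 u.
Proof. by rewrite -scaleN1r norm2Z normrN1 mul1r. Qed.

Lemma le_sqr_norm2 d (u : 'cV[R]_d) (b : R) :
  0 <= b -> dotv u u <= b ^+ 2 -> norm2 u <= b.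
Proof. by move=> b0; rewrite -norm2_sqr ler_sqr// nnegrE norm2_ge0. Qed.

Lemma dotv_norm2 d (u v : 'cV[R]_d) : `|dotv u v| <= norm2 u * norm2 v.
Proof.
rewrite -ler_sqr ?nnegrE ?mulr_ge0 ?norm2_ge0 ?normr_ge0//.
by rewrite exprMn !norm2_sqr real_normK ?num_real// dotv_CauchySchwarz.
Qed.

Lemma norm2D d (u v : 'cV[R]_d) : norm2 (u + v) <= norm2 u + norm2 v.
Proof.
apply: le_sqr_norm2; first by rewrite addr_ge0 ?norm2_ge0.
rewrite !dotv_lin (dotvC v u) -!norm2_sqr.
have := le_trans (ler_norm _) (dotv_norm2 u v); lra.
Qed.

Lemma norm2B d (u v : 'cV[R]_d) : norm2 u - norm2 v <= norm2 (u - v).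
Proof. by rewrite lerBlDr -{1}(subrK v u) norm2D. Qed.

Lemma norm2_normalize d (u : 'cV[R]_d) : 0 < norm2 u -> norm2 (normalize u) = 1.
Proof.
by move=> u0; rewrite norm2Z gtr0_norm ?invr_gt0// mulVf// gt_eqF.
Qed.

End DotProduct.

(** * Deflation and the eigengap *)

Section Deflation.
Variables (R : realType).

(** The reflection across the hyperplane orthogonal to [u - u'] swaps [u] and
    [u']; so orthogonal maps act transitively on the unit sphere. *)
Lemma householder d (u u' : 'cV[R]_d) : dotv u u = 1 -> dotv u' u' = 1 ->
  exists Q : 'M[R]_d, [/\ Q^T = Q, Q *m Q = 1%:M & Q *m u = u'].
Proof.
move=> u1 u'1; have [<-|uu'] := eqVneq u u'.
  by exists 1%:M; rewrite trmx1 !mul1mx.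
pose a := u - u'; pose n := dotv a a.
have n0 : n != 0.
  by apply: contraNneq uu' => /dotv_eq0/eqP; rewrite subr_eq0.
have aa : a^T *m a = n%:M.
  by apply/matrixP => i j; rewrite !ord1 -dotvE mxE eqxx mulr1n.
pose k := 2 / n.
have asym : (a *m a^T)^T = a *m a^T by rewrite trmx_mul trmxK.
exists (1%:M - k *: (a *m a^T)); split.
- by rewrite linearB linearZ /= trmx1 asym.
- rewrite mulmxBl mul1mx mulmxBr mulmx1 -scalemxAl -scalemxAr.
  rewrite mulmxA -(mulmxA a) aa -mulmxA mul_scalar_mx -!scalemxAr !scalerA.
  have -> : k * (k * n) = k + k by rewrite /k; field.
  by rewrite scalerDl opprB addrK subrK.
- have au : a^T *m u = (n / 2)%:M.
    apply/matrixP => i j; rewrite !ord1 -dotvE mxE eqxx mulr1n.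
    by rewrite /n !dotv_lin u1 u'1 (dotvC u' u); field.
  rewrite mulmxBl mul1mx -scalemxAl -mulmxA au mul_mx_scalar scalerA.
  have -> : k * (n / 2) = 1 by rewrite /k; field.
  by rewrite scale1r /a opprB addrC subrK.
Qed.

Lemma char_poly_conj n (Q Q' A : 'M[R]_n) : Q' *m Q = 1%:M ->
  char_poly (Q *m A *m Q') = char_poly A.
Proof.
move=> Q'Q; have QQ' : Q *m Q' = 1%:M by apply: mulmx1C.
rewrite /char_poly.
have -> : char_poly_mx (Q *m A *m Q') =
    map_mx polyC Q *m char_poly_mx A *m map_mx polyC Q'.
  rewrite /char_poly_mx mulmxBr mulmxBl !map_mxM; congr (_ - _).
  by rewrite mul_mx_scalar -scalemxAl -map_mxM QQ' map_scalar_mx scalemx1.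
rewrite !det_mulmx mulrAC -det_mulmx -map_mxM QQ' map_scalar_mx.
by rewrite det1 mul1r.
Qed.

(** Splitting off a unit eigenvector [u] of a symmetric matrix: a reflection
    moves [u] to the first basis vector, which makes the matrix block
    diagonal.  [dotv u v] and [y] are the coordinates of [v] along [u] and on
    its orthogonal complement. *)
Lemma deflation n (X : 'M[R]_n.+1) (u : 'cV[R]_n.+1) (a : R) :
  X^T = X -> dotv u u = 1 -> X *m u = a *: u ->
  exists X' : 'M[R]_n,
    [/\ X'^T = X', char_poly X = ('X - a%:P) * char_poly X' &
        forall v, exists y : 'cV[R]_n,
          dotv v v = dotv u v ^+ 2 + dotv y y /\
          dotv v (X *m v) = a * dotv u v ^+ 2 + dotv y (X' *m y)].
Proof.
move=> Xsym u1 Xu.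
pose e0 : 'cV[R]_(1 + n) := col_mx 1%:M 0.
have dot_col (x1 x2 : 'cV[R]_1) (y1 y2 : 'cV[R]_n) :
    dotv (col_mx x1 y1 : 'cV_(1 + n)) (col_mx x2 y2) =
    x1 0 0 * x2 0 0 + dotv y1 y2.
  rewrite !dotvE tr_col_mx mul_row_col !mxE big_ord1 !mxE.
  by congr (_ + _).
have e01 : dotv e0 e0 = 1.
  by rewrite dot_col !mxE eqxx mulr1 /dotv big1 ?addr0// => i _; rewrite mxE mul0r.
have [Q [Qsym QQ Qu]] := householder u1 e01.
pose Y : 'M[R]_(1 + n) := Q *m X *m Q.
have Ysym : Y^T = Y by rewrite !trmx_mul Qsym Xsym mulmxA.
have Qe : Q *m e0 = u by rewrite -Qu mulmxA QQ mul1mx.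
have Ye : Y *m e0 = a *: e0.
  have -> : Y *m e0 = Q *m (X *m (Q *m e0)) by rewrite !mulmxA.
  by rewrite Qe Xu -scalemxAr Qu.
have YE : Y = block_mx (ulsubmx Y) (ursubmx Y) (dlsubmx Y) (drsubmx Y).
  by rewrite submxK.
have [ul dl] : ulsubmx Y = a%:M /\ dlsubmx Y = 0.
  move: Ye; rewrite YE /e0 mul_block_col !mulmx1 !mulmx0 !addr0.
  rewrite scale_col_mx scaler0 scalemx1 => /eq_col_mx[].
  by rewrite !submxK => -> ->.
have ur : ursubmx Y = 0.
  by rewrite -[LHS]trmxK trmx_ursub Ysym dl trmx0.
rewrite ul dl ur in YE.
exists (drsubmx Y); split.
- by rewrite trmx_drsub Ysym.
- have -> : char_poly X = char_poly Y by rewrite -(char_poly_conj X QQ).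
  rewrite /char_poly /char_poly_mx {1}YE.
  rewrite map_block_mx !raddf0 /= scalar_mx_block opp_block_mx add_block_mx.
  rewrite !oppr0 !addr0 det_ublock map_scalar_mx -raddfB /=.
  by rewrite det_scalar1.
move=> v; pose z : 'cV[R]_(1 + n) := Q *m v.
have vz : v = Q *m z by rewrite /z mulmxA QQ mul1mx.
have QTQ : Q^T *m Q = 1%:M by rewrite Qsym.
have zE : z = col_mx (usubmx z) (dsubmx z) by rewrite vsubmxK.
have z0 : dotv u v = usubmx z 0 0.
  rewrite -(dotv_isometry _ _ QTQ) Qu -/z {1}zE /e0 dot_col.
  rewrite [1%:M _ _]mxE eqxx mul1r [dotv _ _]big1 ?addr0// => i _.
  by rewrite mxE mul0r.
exists (dsubmx z); split.
  by rewrite -(dotv_isometry _ _ QTQ) -/z {1 2}zE dot_col -z0 expr2.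
have -> : dotv v (X *m v) = dotv z (Y *m z).
  by rewrite {1 2}vz -{1}Qsym dotv_mull !mulmxA.
rewrite {1 2}zE {1}YE.
rewrite mul_block_col !mul0mx addr0 add0r dot_col.
by rewrite z0; move: (usubmx z) => x; rewrite mul_scalar_mx mxE; ring.
Qed.

Lemma unit_eigenvector n (X : 'M[R]_n) (a : R) : X^T = X ->
  root (char_poly X) a -> exists2 u, dotv u u = 1 & X *m u = a *: u.
Proof.
move=> Xsym; rewrite -eigenvalue_root_char => /eigenvalueP[v vX v0].
pose w := v^T; have w0 : w != 0 by rewrite -(inj_eq trmx_inj) trmxK trmx0.
have nw : 0 < norm2 w.
  rewrite lt_neqAle norm2_ge0 andbT; apply: contra w0 => /eqP w0.
  by apply/eqP/norm2_eq0.
exists (normalize w).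
  by rewrite -norm2_sqr norm2_normalize// expr1n.
have Xw : X *m w = a *: w by rewrite /w -{1}Xsym -trmx_mul vX linearZ.
by rewrite /normalize -scalemxAr Xw !scalerA mulrC.
Qed.

Lemma rayleigh_le n (X : 'M[R]_n) (s : seq R) (L : R) : X^T = X ->
  char_poly X = \prod_(a <- s) ('X - a%:P) -> {in s, forall a, a <= L} ->
  forall v, dotv v (X *m v) <= L * dotv v v.
Proof.
elim: n X s => [|n IHn] X s Xsym.
  move=> _ _ v; have -> : v = 0 by apply/matrixP => -[].
  by rewrite mulmx0 /dotv big_ord0 mulr0.
case: s => [|a s] Xs sL v.
  by have := size_char_poly X; rewrite Xs big_nil size_poly1.
have [u u1 Xu] : exists2 u, dotv u u = 1 & X *m u = a *: u.
  by apply: unit_eigenvector => //; rewrite Xs root_prod_XsubC mem_head.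
have [X' [X'sym + /(_ v)[y [-> ->]]]] := deflation Xsym u1 Xu.
rewrite Xs big_cons => /(mulfI (negbT (polyXsubC_eq0 _))) X's.
rewrite mulrDr lerD//.
  by rewrite ler_wpM2r ?sqr_ge0// sL ?mem_head.
by apply: (IHn X' s) => // b bs; rewrite sL// in_cons bs orbT.
Qed.

(** The spectral content of the eigengap.  No spectral theorem is invoked: a
    positive gap certifies that the characteristic polynomial splits over the
    reals, since otherwise [eigenvalues] is empty. *)
Lemma leading_eigenpair d (X : 'M[R]_d) (u : 'cV[R]_d) :
  (2 <= d)%N -> X^T = X -> psd X -> 0 < eigengap X ->
  unit_leading_eigenvector X u ->
  [/\ dotv u u = 1, X *m u = lambda_ X 1 *: u, 0 <= lambda_ X 2 &
      forall v, dotv v (X *m v) <=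
        lambda_ X 1 * dotv u v ^+ 2 + lambda_ X 2 * (dotv v v - dotv u v ^+ 2)].
Proof.
case: d X u => [//|n] X u n2 Xsym Xpsd gap [nu Xu].
have u1 : dotv u u = 1 by rewrite -norm2_sqr nu expr1n.
have [s [ssort Xs] sE] : exists2 s, sorted >=%R s /\
    char_poly X = \prod_(a <- s) ('X - a%:P) & eigenvalues X = s.
  move: gap; rewrite /eigengap /lambda_ /eigenvalues /=.
  case: xgetP => [s sE sP _|_]; first by exists s.
  by rewrite subrr ltxx.
have size_s : size s = n.+1.
  by have := size_char_poly X; rewrite Xs size_prod_XsubC => -[].
rewrite /lambda_ sE /= in Xu *.
case: s size_s ssort Xs sE Xu => [//|a [|b s]] /=.
  by move=> [n0]; rewrite -n0 in n2.
move=> [sn] /andP[ab sb] Xs sE Xu; split => //.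
  have [w w1 Xw] : exists2 w, dotv w w = 1 & X *m w = b *: w.
    apply: unit_eigenvector => //.
    by rewrite Xs root_prod_XsubC !inE eqxx orbT.
  by have := Xpsd w; rewrite Xw dotvZr w1 mulr1.
move=> v; have [X' [X'sym + /(_ v)[y [-> ->]]]] := deflation Xsym u1 Xu.
rewrite Xs big_cons => /(mulfI (negbT (polyXsubC_eq0 _))) X's.
rewrite lerD2l addrAC subrr add0r.
apply: (rayleigh_le X'sym (esym X's)) => c.
rewrite in_cons => /predU1P[->//|cs].
have := order_path_min (rev_trans le_trans) sb.
by move=> /allP; apply.
Qed.

End Deflation.

(** * The Huber function *)

Section Huber.
Variables (R : realType) (t : R).

(** The Huber function: it has derivative [clamp] and, in the sense of
    distributions, the indicator of [[-t, t]] as second derivative. *)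
Definition clamp (x : R) : R := Num.max (- t) (Num.min x t).
Definition huber (x : R) : R := clamp x * x - clamp x ^+ 2 / 2.

Lemma clamp_le x : 0 <= t -> `|clamp x| <= t.
Proof.
move=> t0; rewrite ler_norml /clamp le_max lexx /= ge_max ge_min lexx orbT andbT.
lra.
Qed.

Lemma clamp_id x : `|x| <= t -> clamp x = x.
Proof. by rewrite ler_norml /clamp => /andP[xl xr]; rewrite min_l// max_r. Qed.

Lemma huber_sqr x : `|x| <= t -> huber x = x ^+ 2 / 2.
Proof. by move=> xt; rewrite /huber clamp_id//; field. Qed.

(** The Huber function is the supremum of these affine functions. *)
Lemma huber_ge b x : `|b| <= t -> b * x - b ^+ 2 / 2 <= huber x.
Proof.
rewrite ler_norml => /andP[b1 b2]; rewrite /huber /clamp.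
have [xt|tx] := leP x t.
  have [xt'|tx'] := leP x (- t).
    rewrite -subr_ge0
      [X in 0 <= X](_ : _ = (b + t) * ((b - t) / 2 - x)); last by field.
    by apply: mulr_ge0; lra.
  rewrite -subr_ge0 [X in 0 <= X](_ : _ = (x - b) ^+ 2 / 2); last by field.
  by rewrite divr_ge0// sqr_ge0.
rewrite max_r; last lra.
rewrite -subr_ge0 [X in 0 <= X](_ : _ = (t - b) * (x - (b + t) / 2)); last by field.
by apply: mulr_ge0; lra.
Qed.

Lemma huber_ge0 x : 0 <= t -> 0 <= huber x.
Proof.
move=> t0; have := @huber_ge 0 x; rewrite mul0r expr0n mul0r subr0 normr0.
exact.
Qed.

Lemma huber_le x : 0 <= t -> huber x <= t * `|x|.
Proof.
move=> t0; rewrite /huber lerBlDr -[leLHS]addr0 lerD//; last first.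
  by rewrite divr_ge0 ?sqr_ge0.
rewrite (le_trans (ler_norm _))// normrM ler_wpM2r// clamp_le//.
Qed.

Lemma measurable_huber : measurable_fun setT huber.
Proof.
have mc : measurable_fun setT clamp.
  apply: measurable_maxr => //.
  by apply: measurable_minr => //.
apply: measurable_funB; first exact: measurable_funM.
by apply: measurable_funM => //; apply: measurable_funX.
Qed.

(** A second difference of the Huber function in the direction of a rotation
    by a small angle, with cosine [c] and sine [s].  Where the function is
    quadratic the gain is that of the second derivative; elsewhere convexity
    leaves only the loss due to [c < 1]. *)
Lemma huber_second_difference (tau c s x y : R) :
  0 <= s <= tau -> 2 * tau = t -> 0 <= c <= 1 -> c ^+ 2 + s ^+ 2 = 1 ->
  `|y| <= 1 ->
  s ^+ 2 * (y ^+ 2 * (`|x| < tau)%R%:R) + 2 * huber x <=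
  huber (c * x + s * y) + huber (c * x - s * y) + 2 * (1 - c) * (t * `|x|).
Proof.
move=> /andP[s0 st] taut /andP[c0 c1] cs y1.
have t0 : 0 <= t by lra.
have [xtau|taux] := boolP (`|x| < tau); last first.
  rewrite mulr0 mulr0 add0r; set b := clamp x.
  have bt : `|b| <= t by exact: clamp_le.
  have h1 := @huber_ge b (c * x + s * y) bt.
  have h2 := @huber_ge b (c * x - s * y) bt.
  have h3 : b * x <= t * `|x|.
    by rewrite (le_trans (ler_norm _))// normrM ler_wpM2r.
  have h4 : (1 - c) * (b * x) <= (1 - c) * (t * `|x|).
    by rewrite ler_wpM2l// subr_ge0.
  have h5 : huber x = b * x - b ^+ 2 / 2 by [].
  by lra.
have cx : `|c * x| <= tau.
  rewrite normrM ger0_norm//; apply: (le_trans _ (ltW xtau)).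
  by rewrite ler_piMl.
have sy : `|s * y| <= tau.
  rewrite normrM ger0_norm//; apply: le_trans st.
  by rewrite ler_piMr.
have hB : `|c * x - s * y| <= t.
  by rewrite (le_trans (ler_normB _ _))//; lra.
have hD : `|c * x + s * y| <= t.
  by rewrite (le_trans (ler_normD _ _))//; lra.
have hx : `|x| <= t by lra.
rewrite !huber_sqr//.
have h : (1 - c) * (`|x| * (2 * `|x|)) <= (1 - c) * (2 * (t * `|x|)).
  rewrite ler_wpM2l ?subr_ge0//.
  by rewrite mulrCA ler_wpM2l// ler_wpM2r//; lra.
have xx : x ^+ 2 = `|x| * `|x| by rewrite -expr2 real_normK ?num_real.
have h' : (1 + c) * ((1 - c) * (`|x| * `|x|)) <= 2 * ((1 - c) * (`|x| * `|x|)).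
  by rewrite ler_wpM2r ?mulr_ge0 ?subr_ge0//; lra.
have s2 : s ^+ 2 = 1 - c ^+ 2 by rewrite -cs; ring.
have -> : (c * x + s * y) ^+ 2 / 2 + (c * x - s * y) ^+ 2 / 2 =
   c ^+ 2 * x ^+ 2 + s ^+ 2 * y ^+ 2 by field.
rewrite mulr1.
have e : c ^+ 2 * x ^+ 2 = x ^+ 2 - (1 + c) * ((1 - c) * (`|x| * `|x|)).
  by rewrite xx; ring.
by rewrite e; lra.
Qed.

End Huber.

(** * Expectation of bounded random variables *)

Section BoundedExpectation.
Context (R : realType) (d0 : measure_display) (Omega : measurableType d0).
Variable P : probability Omega R.
Implicit Types f g : Omega -> R.
Local Notation Ex f := (\int[P]_w f w).

Definition bounded_rv f := measurable_fun setT f /\ exists M, forall w, `|f w| <= M.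

Lemma bounded_rv_integrable f : bounded_rv f -> P.-integrable setT (EFin \o f).
Proof.
move=> [mf [M fM]]; apply: measurable_bounded_integrable => //.
  by rewrite (le_lt_trans (probability_le1 P _))// ltry.
exists M; split; first exact: num_real.
by move=> x Mx w _ /=; rewrite (le_trans (fM w))// ltW.
Qed.

Lemma bounded_rvD f g : bounded_rv f -> bounded_rv g ->
  bounded_rv (fun w => f w + g w).
Proof.
move=> [mf [M fM]] [mg [N gN]]; split; first exact: measurable_funD.
by exists (M + N) => w; rewrite (le_trans (ler_normD _ _))// lerD.
Qed.

Lemma bounded_rvM f g : bounded_rv f -> bounded_rv g ->
  bounded_rv (fun w => f w * g w).
Proof.
move=> [mf [M fM]] [mg [N gN]]; split; first exact: measurable_funM.
by exists (M * N) => w; rewrite normrM ler_pM.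
Qed.

Lemma bounded_rv_cst c : bounded_rv (fun=> c).
Proof. by split; [exact: measurable_cst|exists `|c|]. Qed.

Lemma ExD f g : bounded_rv f -> bounded_rv g ->
  Ex (fun w => f w + g w) = Ex f + Ex g.
Proof. by move=> bf bg; rewrite RintegralD//; exact: bounded_rv_integrable. Qed.

Lemma ExZ c f : bounded_rv f -> Ex (fun w => c * f w) = c * Ex f.
Proof. by move=> bf; rewrite RintegralZl//; exact: bounded_rv_integrable. Qed.

Lemma Ex_cst c : Ex (fun=> c) = c.
Proof. by rewrite Rintegral_cst// [X in fine X](@probability_setT _ _ _ P) mulr1. Qed.

Lemma Ex_le f g : bounded_rv f -> bounded_rv g -> (forall w, f w <= g w) ->
  Ex f <= Ex g.
Proof. by move=> bf bg fg; apply: le_Rintegral => //; exact: bounded_rv_integrable. Qed.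

Lemma bounded_rv_sum (I : Type) (r : seq I) (A : pred I) (F : I -> Omega -> R) :
  (forall i, bounded_rv (F i)) -> bounded_rv (fun w => \sum_(i <- r | A i) F i w).
Proof.
move=> bF; elim: r => [|i r IHr].
  rewrite [X in bounded_rv X](_ : _ = fun=> 0); first exact: bounded_rv_cst.
  by apply/funext => w; rewrite big_nil.
rewrite [X in bounded_rv X](_ : _ = fun w => (if A i then F i w else 0) +
    \sum_(j <- r | A j) F j w); last first.
  by apply/funext => w; rewrite big_cons; case: ifP => // _; rewrite add0r.
by apply: bounded_rvD => //; case: (A i) => //; exact: bounded_rv_cst.
Qed.

Lemma Ex_sum (I : Type) (r : seq I) (A : pred I) (F : I -> Omega -> R) :
  (forall i, bounded_rv (F i)) ->
  Ex (fun w => \sum_(i <- r | A i) F i w) = \sum_(i <- r | A i) Ex (F i).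
Proof.
move=> bF; elim: r => [|i r IHr].
  rewrite big_nil -[RHS]Ex_cst; apply: eq_Rintegral => w _.
  by rewrite big_nil.
rewrite big_cons -IHr; case: ifP => Ai; last first.
  by apply: eq_Rintegral => w _; rewrite big_cons Ai.
rewrite -ExD//; last exact: bounded_rv_sum.
by apply: eq_Rintegral => w _; rewrite big_cons Ai.
Qed.

Lemma Ex_indic (D : set Omega) : measurable D ->
  Ex (fun w => \1_D w) = fine (P D).
Proof. by move=> mD; rewrite /Rintegral integral_indic// setIT. Qed.

End BoundedExpectation.

(** * Anticoncentration on the sphere *)

Lemma measurable_abs_lt (R : realType) (tau : R) : measurable [set x : R | `|x| < tau].
Proof.
rewrite (_ : [set x | _] = (fun x : R => `|x| < tau) @^-1` [set true]).
  by rewrite -[X in measurable X]setTI; apply: measurable_fun_ltr.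
by apply/funext => x /=; rewrite propeqE.
Qed.

Lemma measurable_indicator (R : realType) (tau : R) :
  measurable_fun setT (fun x : R => (`|x| < tau)%R%:R : R).
Proof.
have /funext -> : (fun x : R => (`|x| < tau)%R%:R : R) =1
    (fun x : R => if `|x| < tau then 1 else 0) by move=> x; case: ifP.
apply: measurable_fun_ifT => //; apply: measurable_fun_ltr => //.
Qed.

Section SphereAnticoncentration.
Context (R : realType) (n : nat) (d0 : measure_display).
Context (Omega : measurableType d0) (P : probability Omega R).
Variable W : Omega -> 'cV[R]_n.+1.
Hypothesis unifW : uniform_unit_vector P W.
Implicit Types u v : 'cV[R]_n.+1.
Local Notation Ex f := (\int[P]_w f w).

Lemma continuous_dotv u : continuous (fun w : 'cV[R]_n.+1 => dotv u w).
Proof.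
apply: (@continuous_big R^o _ +%R 0 xpredT) => [|i _ w].
  exact: add_continuous.
apply: (@continuous_comp _ _ _ (fun x : 'cV[R]_n.+1 => x i ord0)
                               (fun y : R => u i ord0 * y)).
  exact: coord_continuous.
exact: mulrl_continuous.
Qed.

Lemma measurable_preimage_dotv u (C : set R) : measurable C ->
  <<s @open 'cV[R]_n.+1 >> ((fun w => dotv u w) @^-1` C).
Proof.
move=> mC.
have : measurable_fun [set: g_sigma_algebraType (@open 'cV[R]_n.+1)]
    (fun w : 'cV[R]_n.+1 => dotv u w).
  apply: (measurability _ (RGenOInfty.measurableE R)) => //.
  move=> /= _ [_ [a ->]] <-; rewrite setTI; apply: sub_sigma_algebra.
  move/continuousP: (@continuous_dotv u); apply.
  exact: interval_open.
by move=> /(_ measurableT _ mC); rewrite setTI.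
Qed.

Lemma measurable_coordinate u : measurable_fun setT (fun w => dotv u (W w)).
Proof.
have [mW _ _] := unifW; move=> _ C mC; rewrite setTI.
by apply: (mW (_ @^-1` _)); exact: measurable_preimage_dotv.
Qed.

Lemma coordinate_le1 u w : dotv u u = 1 -> `|dotv u (W w)| <= 1.
Proof.
have [_ nW _] := unifW; move=> u1; rewrite (le_trans (dotv_norm2 _ _))//.
by rewrite nW mulr1 /norm2 u1 sqrtr1.
Qed.

(** All coordinates of a uniform unit vector have the same law, as orthogonal
    maps act transitively on unit vectors. *)
Lemma coordinate_law u v (C : set R) : dotv u u = 1 -> dotv v v = 1 ->
  measurable C ->
  P ((fun w => dotv u (W w)) @^-1` C) = P ((fun w => dotv v (W w)) @^-1` C).
Proof.
move=> u1 v1 mC; have [_ _ rotW] := unifW.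
have [Q [Qsym QQ <-]] := householder u1 v1.
have QTQ : Q^T *m Q = 1%:M by rewrite Qsym.
rewrite -(rotW _ _ QTQ (measurable_preimage_dotv u mC)).
congr (P _); apply/funext => w /=.
by rewrite /preimage/= -{2}Qsym dotv_mull.
Qed.

Lemma coordinate_expectation (phi : R -> R) u v :
  dotv u u = 1 -> dotv v v = 1 ->
  measurable_fun setT phi -> (forall x, 0 <= phi x) ->
  Ex (fun w => phi (dotv u (W w))) = Ex (fun w => phi (dotv v (W w))).
Proof.
move=> u1 v1 mphi phi0; rewrite /Rintegral; congr fine.
have push x : (\int[P]_w (phi (dotv x (W w)))%:E =
    \int[pushforward P (fun w => dotv x (W w))]_y (phi y)%:E)%E.
  rewrite ge0_integral_pushforward//.
  - exact: measurable_coordinate.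
  - exact/measurable_EFinP.
  - by move=> y _; rewrite lee_fin.
rewrite !push; apply: eq_measure_integral => [||mv mu C mC _].
- exact: measurable_coordinate.
- exact: measurable_coordinate.
- exact: coordinate_law.
Qed.

Let e i : 'cV[R]_n.+1 := delta_mx i ord0.

Let dotv_e i w : dotv (e i) w = w i ord0.
Proof.
rewrite /dotv (bigD1 i)//= big1 ?addr0 => [|j ji].
  by rewrite mxE !eqxx mul1r.
by rewrite mxE (negbTE ji) mul0r.
Qed.

Let e1 i : dotv (e i) (e i) = 1.
Proof. by rewrite dotv_e mxE !eqxx. Qed.

Let bounded_coordinate u (phi : R -> R) (M : R) : dotv u u = 1 ->
  measurable_fun setT phi -> (forall x, `|x| <= 1 -> `|phi x| <= M) ->
  bounded_rv (fun w => phi (dotv u (W w))).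
Proof.
move=> u1 mphi phiM; split.
  by apply: measurableT_comp => //; exact: measurable_coordinate.
by exists M => w; rewrite phiM// coordinate_le1.
Qed.

Let bcoord u : dotv u u = 1 -> bounded_rv (fun w => dotv u (W w)).
Proof. by move=> u1; apply: (@bounded_coordinate u id 1). Qed.

Let bcoord2 u : dotv u u = 1 -> bounded_rv (fun w => dotv u (W w) ^+ 2).
Proof.
move=> /bcoord bu; have /funext -> : (fun w => dotv u (W w) ^+ 2) =1
  (fun w => dotv u (W w) * dotv u (W w)) by move=> w; rewrite expr2.
exact: bounded_rvM.
Qed.

Let sum_coord2 w : \sum_i dotv (e i) (W w) ^+ 2 = 1.
Proof.
have [_ nW _] := unifW; rewrite -[RHS](expr1n _ 2) -(nW w) norm2_sqr.
by apply: eq_bigr => i _; rewrite dotv_e expr2.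
Qed.

Lemma coordinate_second_moment u : dotv u u = 1 ->
  Ex (fun w => dotv u (W w) ^+ 2) = n.+1%:R^-1.
Proof.
move=> u1.
have Eq i : Ex (fun w => dotv (e i) (W w) ^+ 2) = Ex (fun w => dotv u (W w) ^+ 2).
  by apply: (@coordinate_expectation (fun x => x ^+ 2)) => // x; exact: sqr_ge0.
have : Ex (fun w => \sum_i dotv (e i) (W w) ^+ 2) = 1.
  by rewrite -[RHS](Ex_cst P 1); apply: eq_Rintegral => w _; exact: sum_coord2.
rewrite Ex_sum; last by move=> i; exact: bcoord2.
under eq_bigr do rewrite Eq.
rewrite sumr_const card_ord => x1.
have n0 : n.+1%:R != 0 :> R by rewrite pnatr_eq0.
by apply: (mulfI n0); rewrite mulfV// mulr_natl.
Qed.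

(** Invariance under a rotation in the plane of two orthonormal directions
    makes the expectation of the second difference of the Huber function
    vanish. *)
Lemma rotation_bound (tau c s : R) (i j : 'I_n.+1) : i != j ->
  0 <= s <= tau -> 0 <= c <= 1 -> c ^+ 2 + s ^+ 2 = 1 ->
  s ^+ 2 * Ex (fun w => dotv (e j) (W w) ^+ 2 *
                 (`|dotv (e i) (W w)| < tau)%R%:R) <=
  4 * (1 - c) * tau / Num.sqrt n.+1%:R.
Proof.
move=> ij stau c01 cs; pose t := 2 * tau; pose h := huber t.
have t0 : 0 <= t by rewrite /t; lra.
have eij : dotv (e i) (e j) = 0 by rewrite dotv_e mxE (negbTE ij).
pose up := c *: e i + s *: e j; pose um := c *: e i - s *: e j.
have up1 : dotv up up = 1.
  by rewrite !dotv_lin !e1 (dotvC (e j)) eij -[RHS]cs; ring.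
have um1 : dotv um um = 1.
  by rewrite !dotv_lin !e1 (dotvC (e j)) eij -[RHS]cs; ring.
have bh u : dotv u u = 1 -> bounded_rv (fun w => h (dotv u (W w))).
  move=> u1; apply: (@bounded_coordinate u h t) => //.
    exact: measurable_huber.
  move=> x x1; rewrite ger0_norm ?huber_ge0// (le_trans (huber_le _ _))//.
  by rewrite ler_piMr.
have Eh u : dotv u u = 1 ->
    Ex (fun w => h (dotv u (W w))) = Ex (fun w => h (dotv (e i) (W w))).
  move=> u1; apply: (@coordinate_expectation h) => //.
    exact: measurable_huber.
  by move=> x; exact: huber_ge0.
pose I w : R := (`|dotv (e i) (W w)| < tau)%R%:R.
have bI : bounded_rv I.
  apply: (@bounded_coordinate (e i) (fun x => (`|x| < tau)%R%:R) 1) => //.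
    apply: measurable_indicator.
  by move=> x _; case: (_ < _); rewrite ?normr1 ?normr0.
pose r := Num.sqrt (n.+1%:R : R).
have r0 : 0 < r by rewrite sqrtr_gt0 ltr0n.
have rr : r ^+ 2 = n.+1%:R by rewrite sqr_sqrtr// ler0n.
pose F w := s ^+ 2 * (dotv (e j) (W w) ^+ 2 * I w) + 2 * h (dotv (e i) (W w)).
pose k := (1 - c) * t.
pose G w := h (dotv up (W w)) + h (dotv um (W w))
  + (k * r * (dotv (e i) (W w) ^+ 2) + k / r).
have FG w : F w <= G w.
  have := @huber_second_difference R t tau c s (dotv (e i) (W w))
            (dotv (e j) (W w)) stau erefl c01 cs (coordinate_le1 _ (e1 j)).
  rewrite -/h -/(I w) => /le_trans; apply.
  rewrite /G !dotv_lin lerD2l.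
  set x := dotv _ _.
  have -> : 2 * (1 - c) * (t * `|x|) = k * (2 * `|x|) by rewrite /k; ring.
  (* [2 * `|x| <= r * x ^+ 2 + 1 / r] bounds the first absolute moment by the
     second one. *)
  rewrite -mulrA -mulrDr ler_wpM2l//.
    by rewrite /k mulr_ge0// subr_ge0; case/andP: c01.
  rewrite -subr_ge0 [X in 0 <= X](_ : _ = (r * `|x| - 1) ^+ 2 / r).
    by rewrite divr_ge0 ?sqr_ge0// ltW.
  by rewrite -[x ^+ 2]real_normK ?num_real//; field; rewrite gt_eqF.
have bA : bounded_rv (fun w => s ^+ 2 * (dotv (e j) (W w) ^+ 2 * I w)).
  apply: bounded_rvM; first exact: bounded_rv_cst.
  by apply: bounded_rvM => //; exact: bcoord2.
have bB : bounded_rv (fun w => 2 * h (dotv (e i) (W w))).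
  by apply: bounded_rvM; [exact: bounded_rv_cst|exact: bh].
have bC : bounded_rv (fun w => k * r * (dotv (e i) (W w) ^+ 2)).
  by apply: bounded_rvM; [exact: bounded_rv_cst|exact: bcoord2].
have bk : bounded_rv (fun _ : Omega => k / r) by exact: bounded_rv_cst.
have bCk := bounded_rvD bC bk.
have bhh := bounded_rvD (bh _ up1) (bh _ um1).
have := Ex_le P (bounded_rvD bA bB) (bounded_rvD bhh bCk) FG.
rewrite (ExD P bA bB) (ExD P bhh bCk) (ExD P bC bk) Ex_cst.
rewrite (ExD P (bh _ up1) (bh _ um1)) !Eh// (ExZ P _ (bh _ (e1 i))).
rewrite (ExZ P _ (bcoord2 (e1 i))) (ExZ P _ (bounded_rvM (bcoord2 (e1 j)) bI)).
have rV : n.+1%:R^-1 = r ^- 2 by rewrite -rr.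
rewrite coordinate_second_moment// rV /I -/r.
have -> : k * r * r ^- 2 + k / r = 4 * (1 - c) * tau / r.
  by rewrite /k /t; field; rewrite gt_eqF.
by lra.
Qed.

(** The marginal density of a uniform unit vector is at most of order the
    square root of the dimension, with a constant small enough for the present
    use.  The estimate of [rotation_bound] is summed over the directions
    orthogonal to a coordinate, with a rotation of angle comparable with
    [tau]. *)
Lemma sphere_anticoncentration (u : 'cV[R]_n.+1) (p : R) :
  (0 < n)%N -> dotv u u = 1 -> 0 < p < 1 ->
  fine (P [set w | `|dotv u (W w)| < p / (3 * Num.sqrt n.+1%:R)]) <= p.
Proof.
move=> n0 u1 /andP[p0 p1].
pose r := Num.sqrt (n.+1%:R : R).
have r0 : 0 < r by rewrite sqrtr_gt0 ltr0n.
have rr : r ^+ 2 = n.+1%:R by rewrite sqr_sqrtr// ler0n.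
rewrite -/r; set tau := p / (3 * r).
have tau0 : 0 < tau by rewrite /tau divr_gt0// mulr_gt0.
have r2 : 2 <= r ^+ 2 by rewrite rr ler_nat.
have tau_r : tau * r = p / 3 by rewrite /tau; field; rewrite gt_eqF.
have tau2 : tau ^+ 2 <= 1 / 18.
  have : tau ^+ 2 * r ^+ 2 <= 1 / 9.
    by rewrite -exprMn tau_r expr2; nra.
  have := ler_wpM2l (sqr_ge0 tau) r2; lra.
pose c := Num.sqrt (1 - tau ^+ 2).
have c2 : c ^+ 2 = 1 - tau ^+ 2 by rewrite sqr_sqrtr//; lra.
have c0 : 0 <= c by exact: sqrtr_ge0.
have c1 : c <= 1.
  rewrite -(@ler_pXn2r _ 2) ?nnegrE// c2 expr1n.
  by have := sqr_ge0 tau; lra.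
have cs : c ^+ 2 + tau ^+ 2 = 1 by rewrite c2; ring.
pose I w : R := (`|dotv (e ord0) (W w)| < tau)%R%:R.
have bI : bounded_rv I.
  apply: (@bounded_coordinate (e ord0) (fun x => (`|x| < tau)%R%:R) 1) => //.
    exact: measurable_indicator.
  by move=> x _; case: (_ < _); rewrite ?normr1 ?normr0.
have PI : fine (P [set w | `|dotv u (W w)| < tau]) = Ex I.
  have mC := measurable_abs_lt tau.
  rewrite [P _](coordinate_law u1 (e1 ord0) mC) -Ex_indic.
    by apply: eq_Rintegral => w _; rewrite indicE /I mem_setE.
  by rewrite -[X in measurable X]setTI; apply: measurable_coordinate.
rewrite PI.
have bJ j : bounded_rv (fun w => dotv (e j) (W w) ^+ 2 * I w).
  by apply: bounded_rvM => //; exact: bcoord2.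
pose K := 4 * (1 - c) * tau / r.
have h1 : tau ^+ 2 * Ex (fun w => \sum_(j | j != ord0) dotv (e j) (W w) ^+ 2 * I w)
    <= n%:R * K.
  rewrite Ex_sum// mulr_sumr.
  apply: (@le_trans _ _ (\sum_(j < n.+1 | j != ord0) K)).
    apply: ler_sum => j j0; apply: rotation_bound => //.
    - by rewrite eq_sym.
    - by rewrite ltW//=.
    - by rewrite c0.
  by rewrite big_mkcond big_ord_recl /= add0r sumr_const card_ord mulr_natl.
have h2 : (1 - tau ^+ 2) * Ex I <=
    Ex (fun w => \sum_(j | j != ord0) dotv (e j) (W w) ^+ 2 * I w).
  rewrite -ExZ//; apply: Ex_le.
  - by apply: bounded_rvM => //; exact: bounded_rv_cst.
  - exact: bounded_rv_sum.
  move=> w; rewrite -mulr_suml.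
  have := sum_coord2 w; rewrite (bigD1 ord0)//= => /(canRL (addKr _)) ->.
  rewrite [- _ + 1]addrC.
  rewrite /I; case: ltP => h; last by rewrite !mulr0.
  rewrite !mulr1 lerD2l lerN2 -real_normK ?num_real//.
  by rewrite ler_pXn2r ?nnegrE// ltW.
have EI0 : 0 <= Ex I by apply: Rintegral_ge0 => w _; rewrite /I ler0n.
have c_ge : 17 / 18 <= c.
  by apply: le_trans (_ : c ^+ 2 <= c); [rewrite c2; lra|rewrite expr2 ler_piMl].
have c1_le : 1 - c <= 18 / 35 * tau ^+ 2.
  have -> : tau ^+ 2 = (1 - c) * (1 + c) by rewrite -[tau ^+ 2](addKr (c ^+ 2)) cs; ring.
  have c'0 : 0 <= 1 - c by lra.
  by have := ler_wpM2l c'0 c_ge; lra.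
have K_le : n%:R * K <= tau ^+ 2 * (24 / 35 * p).
  have -> : K = 4 * (1 - c) * (p / 3) / n.+1%:R.
    by rewrite /K -tau_r -rr; field; rewrite gt_eqF.
  rewrite mulrCA mulrA ler_pdivrMr ?ltr0n// mulrC.
  rewrite [leRHS]mulrC; apply: ler_pM => //.
  - by rewrite mulr_ge0//; lra.
  - by rewrite ler_nat.
  - by have := ler_wpM2r (ltW p0) c1_le; lra.
have : tau ^+ 2 * ((1 - tau ^+ 2) * Ex I) <= tau ^+ 2 * (24 / 35 * p).
  apply: le_trans K_le; apply: le_trans h1.
  by rewrite ler_wpM2l// sqr_ge0.
rewrite ler_pM2l ?exprn_gt0// => h.
have : 17 / 18 * Ex I <= 24 / 35 * p.
  apply: le_trans h; rewrite ler_wpM2r//; lra.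
by lra.
Qed.

End SphereAnticoncentration.

(** * Perturbed power iterations *)

Section PowerIteration.
Variables (R : realType) (d : nat).
Implicit Types u v w : 'cV[R]_d.

(** In a log-convex sequence the ratios of consecutive terms increase, so the
    last ratio dominates the geometric mean of the preceding ones. *)
Lemma logconvex_ratio (c : nat -> R) (theta : R) (N : nat) :
  (forall k, 0 < c k) -> (forall k, c k.+1 ^+ 2 <= c k * c k.+2) ->
  0 < theta -> theta ^+ N * c 0%N < c N -> theta * c N < c N.+1.
Proof.
move=> c0 cc t0 cN; rewrite ltNge; apply/negP => cN1.
have down k : (k <= N)%N -> c (N - k).+1 <= theta * c (N - k)%N.
  elim: k => [|k IHk] kN; first by rewrite subn0.
  have := IHk (ltnW kN); rewrite -subSS subSn; last exact: kN.
  set j := (N - k.+1)%N => h.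
  rewrite -(ler_pM2l (c0 j.+1)) -expr2 (le_trans (cc j))//.
  have -> : c j.+1 * (theta * c j) = c j * (theta * c j.+1) by ring.
  by rewrite ler_wpM2l// ltW.
have up k : (k <= N)%N -> c k <= theta ^+ k * c 0%N.
  elim: k => [|k IHk] kN; first by rewrite mul1r.
  have := down (N - k)%N (leq_subr _ _); rewrite subKn; last exact: ltnW.
  move=> /le_trans; apply; rewrite exprS -mulrA ler_pM2l//.
  exact/IHk/ltnW.
by have := lt_le_trans cN (up N (leqnn N)); rewrite ltxx.
Qed.

(** The operators met below are [S = g *: invmx (lam%:M - X)] with
    [g = lam - lambda_ X 1]: the inverse power step, scaled so as to fix the
    leading eigenvector. *)
Record normalized_step (S : 'M[R]_d) (u : 'cV[R]_d) (q : R) : Prop := {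
  step_sym : S^T = S;
  step_psd : psd S;
  step_unit : dotv u u = 1;
  step_fix : S *m u = u;
  step_le : forall v, norm2 (S *m v) <= norm2 v;
  step_orth : forall v, dotv u v = 0 -> norm2 (S *m v) <= q * norm2 v }.

Variables (S : 'M[R]_d) (u : 'cV[R]_d) (q : R).
Hypothesis stepS : normalized_step S u q.
Hypothesis q0 : 0 <= q.

Definition power (w : 'cV[R]_d) t := iter t (mulmx S) w.

Lemma dotv_step v w : dotv v (S *m w) = dotv (S *m v) w.
Proof. by rewrite -dotv_mull (step_sym stepS). Qed.

Lemma dotv_fix v : dotv u (S *m v) = dotv u v.
Proof. by rewrite dotv_step (step_fix stepS). Qed.

Lemma dotv_power w t : dotv u (power w t) = dotv u w.
Proof. by elim: t => [//|t IHt]; rewrite /power iterS dotv_fix. Qed.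

Lemma dotv_unit_le v : dotv u v ^+ 2 <= dotv v v.
Proof.
by rewrite -[leRHS]mul1r -[X in X * _](step_unit stepS) dotv_CauchySchwarz.
Qed.

Lemma power_ge w m : dotv u w ^+ 2 <= dotv (power w m) (power w m).
Proof. by rewrite -(dotv_power w m) dotv_unit_le. Qed.

Lemma power_moments w i j : dotv (power w i) (power w j) = dotv w (power w (i + j)).
Proof.
elim: i j => [//|i IHi] j; rewrite {1}/power iterS -dotv_step.
by rewrite -[S *m _]/(power w j.+1) IHi addnS.
Qed.

(** A Rayleigh quotient bound that needs no eigengap.  The moments
    [c k = dotv w (power w k)] are log-convex: [c k ^+ 2 <= c k.-1 * c k.+1]
    is the Cauchy-Schwarz inequality, for the standard inner product when [k]
    is odd and for the one defined by [S] when [k] is even.  Those of even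
    index are at least [dotv u w ^+ 2], so the ratios must come close to 1. *)
Lemma power_rayleigh w m theta : dotv w w = 1 -> 0 < theta ->
  theta ^+ (2 * m) < dotv u w ^+ 2 ->
  theta * dotv (power w m) (power w m) <= dotv (power w m) (S *m power w m).
Proof.
move=> w1 t0 tm; pose c k := dotv w (power w k).
have uw0 : 0 < dotv u w ^+ 2 by apply: le_lt_trans tm; rewrite exprn_ge0// ltW.
have c_even k : dotv u w ^+ 2 <= c (k + k)%N.
  by rewrite /c -power_moments power_ge.
have c_conv k : c k.+1 ^+ 2 <= c k * c k.+2.
  rewrite -(odd_double_half k) -addnn; set j := k./2; case: (odd k) => /=.
    rewrite add1n; have -> : ((j + j).+3 = j.+1 + j.+2)%N by rewrite !addSn !addnS.
    have -> : ((j + j).+2 = j.+1 + j.+1)%N by rewrite addSn addnS.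
    have -> : ((j + j).+1 = j + j.+1)%N by rewrite addnS.
    rewrite /c -!power_moments -[power w j.+2]/(S *m power w j.+1).
    rewrite -{1}[power w j.+1]/(S *m power w j) -dotv_step.
    rewrite -[power w j.+1 in X in _ <= X * _]/(S *m power w j).
    rewrite -[in X in _ <= X]/(power w j.+1).
    exact: (psd_CauchySchwarz _ _ (step_sym stepS) (step_psd stepS)).
  rewrite add0n; have -> : ((j + j).+2 = j.+1 + j.+1)%N by rewrite addSn addnS.
  have -> : ((j + j).+1 = j + j.+1)%N by rewrite addnS.
  by rewrite /c -!power_moments dotv_CauchySchwarz.
have c_pos k : 0 < c k.
  rewrite -(odd_double_half k) -addnn; set j := k./2.
  have e0 i : 0 < c (i + i)%N by apply: lt_le_trans (c_even i).
  case: (odd k) => /=; last exact: e0.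
  rewrite add1n lt_neqAle; apply/andP; split; last first.
    by rewrite -addnS /c -power_moments; exact: (step_psd stepS).
  apply/eqP => c1; have := c_conv (j + j).+1; rewrite -c1 mul0r.
  have := e0 j.+1; rewrite addSn addnS => ej.
  by rewrite leNgt exprn_gt0.
have := @logconvex_ratio c theta (m + m) c_pos c_conv t0.
rewrite {1}/c w1 mulr1 addnn -mul2n => /(_ (lt_le_trans tm _)).
rewrite mul2n -addnn -addnS /c -!power_moments => /(_ (power_ge w m)).
exact: ltW.
Qed.

Lemma step_dotv_le v : dotv v (S *m v) <= dotv v v.
Proof.
rewrite (le_trans (ler_norm _))// (le_trans (dotv_norm2 _ _))//.
by rewrite -norm2_sqr expr2 ler_wpM2l ?norm2_ge0// (step_le stepS).
Qed.

(** Crude phase: a constant-factor leading eigenvalue estimate, stable under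
    perturbations that are small relative to the overlap [dotv u w]. *)
Lemma crude_estimate w m y : dotv w w = 1 ->
  (15 / 16) ^+ (2 * m) < dotv u w ^+ 2 ->
  norm2 (y - power w m) <= `|dotv u w| / 100 ->
  0 < norm2 y /\
  7 / 8 <= dotv (normalize y) (S *m normalize y) <= 1.
Proof.
move=> w1 tm ye; set z := power w m in ye *; pose e := y - z.
have yE : y = z + e by rewrite /e addrC subrK.
rewrite -/e in ye; clearbody e.
set a := `|_| in ye.
have a0 : 0 < a.
  rewrite normr_gt0; apply: contraTneq tm => ->.
  by rewrite expr0n -leNgt exprn_ge0.
have za : a <= norm2 z.
  rewrite -ler_sqr ?nnegrE ?norm2_ge0 ?normr_ge0//.
  by rewrite norm2_sqr real_normK ?num_real// power_ge.
have ez : norm2 e <= norm2 z / 100 by lra.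
have z0 : 0 < norm2 z by lra.
have y0 : 0 < norm2 y.
  by rewrite yE; have := norm2B z (- e); rewrite opprK norm2N; lra.
have ylt : norm2 y <= 101 / 100 * norm2 z.
  by rewrite yE (le_trans (norm2D _ _))//; lra.
have nn v : dotv (normalize v) (S *m normalize v) = dotv v (S *m v) / norm2 v ^+ 2.
  by rewrite /normalize -scalemxAr dotvZl dotvZr expr2 invfM; ring.
split=> //; rewrite nn ler_pdivlMr ?exprn_gt0// ler_pdivrMr ?exprn_gt0// mul1r.
apply/andP; split; last by rewrite norm2_sqr step_dotv_le.
have zz := power_rayleigh w1 (_ : 0 < 15 / 16) tm.
have {zz} : 15 / 16 * norm2 z ^+ 2 <= dotv z (S *m z).
  by rewrite norm2_sqr zz//; lra.
have : `|dotv e (S *m z)| <= norm2 z ^+ 2 / 100.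
  rewrite (le_trans (dotv_norm2 _ _))// expr2 mulrAC.
  by rewrite ler_pM ?norm2_ge0// (step_le stepS).
have : 0 <= dotv e (S *m e) by exact: (step_psd stepS).
have : norm2 y ^+ 2 <= (101 / 100) ^+ 2 * norm2 z ^+ 2.
  by rewrite -exprMn ler_sqr// nnegrE ?norm2_ge0// ltW// mulr_gt0//; lra.
have SD (v v' : 'cV[R]_d) : dotv (v + v') (S *m (v + v')) =
    dotv v (S *m v) + 2 * dotv v' (S *m v) + dotv v' (S *m v').
  by rewrite mulmxDr !dotv_lin (dotv_step v v') (dotvC (S *m v)); ring.
rewrite yE (SD z e) ler_norml => h1 h2 /andP[h3 h4] h5.
have := sqr_ge0 (norm2 z); lra.
Qed.

Lemma power_orth w m : norm2 (power w m - dotv u w *: u) <= q ^+ m * norm2 w.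
Proof.
pose w' := w - dotv u w *: u.
have uw' : dotv u w' = 0 by rewrite dotvBr dotvZr (step_unit stepS) mulr1 subrr.
have pE t : power w t - dotv u w *: u = power w' t.
  elim: t => [//|t IHt]; rewrite /power !iterS -/(power w' t) -IHt mulmxBr.
  by rewrite -scalemxAr (step_fix stepS).
have ww' : norm2 w' <= norm2 w.
  apply: le_sqr_norm2; first exact: norm2_ge0.
  rewrite norm2_sqr /w' !dotv_lin (step_unit stepS) (dotvC w u).
  have := sqr_ge0 (dotv u w); lra.
rewrite pE (@le_trans _ _ (q ^+ m * norm2 w'))//; last first.
  by rewrite ler_wpM2l// exprn_ge0.
elim: m => [|t IHt]; first by rewrite mul1r.
rewrite {1}/power iterS (le_trans (step_orth stepS _))//.
  by rewrite -/(power w' t) dotv_power.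
by rewrite exprS -mulrA ler_wpM2l.
Qed.

(** Accurate phase: the component along [u] keeps the size of the initial
    overlap, while the orthogonal one has decayed by the factor [q ^+ m]. *)
Lemma accurate_estimate w m y eps : dotv w w = 1 -> 0 < eps < 1 ->
  dotv u w != 0 ->
  (q ^+ m) ^+ 2 <= dotv u w ^+ 2 * (eps / 2) ->
  norm2 (y - power w m) <= `|dotv u w| * (eps / 32) ->
  0 < norm2 y /\ 1 - eps <= dotv (normalize y) u ^+ 2.
Proof.
move=> w1 /andP[eps0 eps1] uw0 qm; set z := power w m; set e := y - z => ez.
have yE : y = z + e by rewrite /e addrC subrK.
clearbody e; pose a := `|dotv u w|; have a0 : 0 < a by rewrite normr_gt0.
have aa : dotv u w ^+ 2 = a ^+ 2 by rewrite real_normK ?num_real.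
have nw : norm2 w = 1 by rewrite /norm2 w1 sqrtr1.
have nu : norm2 u = 1 by rewrite /norm2 (step_unit stepS) sqrtr1.
have uy_ge : a * (31 / 32) <= `|dotv u y|.
  rewrite yE dotvDr dotv_power.
  have := lerB_normD (dotv u w) (dotv u e).
  have := dotv_norm2 u e; rewrite nu mul1r -/a => h1 h2.
  have : a * (eps / 32) <= a * (1 / 32) by rewrite ler_wpM2l ?ltW//; lra.
  move: ez; rewrite -/a; lra.
have uy2 : a ^+ 2 * (31 / 32) ^+ 2 <= dotv u y ^+ 2.
  rewrite -[leRHS]real_normK ?num_real// -exprMn ler_sqr// nnegrE.
  by rewrite mulr_ge0 ?(ltW a0)//; lra.
have uy_gt0 : 0 < dotv u y ^+ 2.
  by apply: lt_le_trans uy2; rewrite mulr_gt0 ?exprn_gt0//; lra.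
have yy : dotv u y ^+ 2 <= dotv y y := dotv_unit_le y.
have yy0 : 0 < norm2 y ^+ 2 by rewrite norm2_sqr; exact: lt_le_trans yy.
have ny0 : 0 < norm2 y.
  by rewrite lt_neqAle norm2_ge0 andbT; apply: contraTneq yy0 => <-; rewrite expr0n ltxx.
split=> //; rewrite /normalize dotvZl dotvC exprMn exprVn mulrC.
rewrite ler_pdivlMr// norm2_sqr.
pose y' := y - dotv u y *: u.
have yE' : dotv y y = dotv u y ^+ 2 + norm2 y' ^+ 2.
  rewrite norm2_sqr /y' !dotv_lin (step_unit stepS) (dotvC y u); ring.
have y'_le : norm2 y' <= q ^+ m + a * (eps / 32).
  have -> : y' = (z - dotv u w *: u) + (e - dotv u e *: u).
    rewrite /y' {2}yE dotvDr dotv_power scalerDl {1}yE opprD.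
    by rewrite addrACA.
  rewrite (le_trans (norm2D _ _))// lerD//.
    by rewrite -[leRHS]mulr1 -nw power_orth.
  apply: le_trans ez; apply: le_sqr_norm2; first exact: norm2_ge0.
  rewrite norm2_sqr !dotv_lin (step_unit stepS) (dotvC e u).
  have := sqr_ge0 (dotv u e); lra.
have y'2 : norm2 y' ^+ 2 <= eps * dotv u y ^+ 2.
  apply: (@le_trans _ _ ((q ^+ m + a * (eps / 32)) ^+ 2)).
    rewrite ler_sqr// nnegrE ?norm2_ge0//.
    by rewrite addr_ge0 ?exprn_ge0// mulr_ge0 ?(ltW a0)//; lra.
  (* Young's inequality: most of the budget [eps] goes to [q ^+ m]. *)
  apply: (@le_trans _ _ (3 / 2 * (q ^+ m) ^+ 2 + 3 * (a * (eps / 32)) ^+ 2)).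
    rewrite -subr_ge0.
    rewrite [leRHS](_ : _ = (q ^+ m - 2 * (a * (eps / 32))) ^+ 2 / 2);
      last by field.
    by rewrite divr_ge0 ?sqr_ge0.
  rewrite aa in qm.
  have : eps * (a ^+ 2 * (31 / 32) ^+ 2) <= eps * dotv u y ^+ 2.
    by rewrite ler_wpM2l// ltW.
  have : eps * (eps * a ^+ 2) <= 1 * (eps * a ^+ 2).
    by rewrite ler_wpM2r ?mulr_ge0 ?sqr_ge0 ?ltW.
  have : 0 <= eps * a ^+ 2 by rewrite mulr_ge0 ?sqr_ge0 ?ltW.
  lra.
rewrite yE'; have : 0 <= eps * norm2 y' ^+ 2 by rewrite mulr_ge0 ?sqr_ge0 ?ltW.
lra.
Qed.

End PowerIteration.

(** * Shifted inverses *)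

Section ShiftedInverse.
Variables (R : realType) (d : nat) (X : 'M[R]_d) (u : 'cV[R]_d).
Variables (l1 l2 lam : R).
Hypothesis Xsym : X^T = X.
Hypothesis u1 : dotv u u = 1.
Hypothesis Xu : X *m u = l1 *: u.
Hypothesis Xle : forall v, dotv v (X *m v) <=
  l1 * dotv u v ^+ 2 + l2 * (dotv v v - dotv u v ^+ 2).
Hypothesis l21 : l2 < l1.
Hypothesis l1lam : l1 < lam.

Let M := lam%:M - X.
Let g := lam - l1.
Let g0 : 0 < g. Proof. by rewrite subr_gt0. Qed.

Let Msym : M^T = M.
Proof. by rewrite /M linearB /= tr_scalar_mx Xsym. Qed.

Let M_ge v : g * dotv v v + (l1 - l2) * (dotv v v - dotv u v ^+ 2) <=
  dotv v (M *m v).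
Proof.
rewrite /M mulmxBl mul_scalar_mx dotvBr dotvZr; have := Xle v; rewrite /g; lra.
Qed.

Let M_ge_norm v : g * dotv v v <= dotv v (M *m v).
Proof.
apply: le_trans (M_ge v); rewrite lerDl mulr_ge0 ?subr_ge0 ?(ltW l21)//.
by rewrite -[leRHS]mul1r -[X in X * _]u1 dotv_CauchySchwarz.
Qed.

Let M_unit : M \in unitmx.
Proof.
rewrite -row_free_unit; apply: inj_row_free => v vM.
apply: trmx_inj; rewrite trmx0; apply: dotv_eq0; apply: le_anti.
rewrite dotv_ge0 andbT -(pmulr_rle0 _ g0) (le_trans (M_ge_norm _))//.
have -> : M *m v^T = 0 by rewrite -Msym -trmx_mul vM trmx0.
by rewrite /dotv big1// => i _; rewrite mxE mxE mulr0.
Qed.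

Let S := g *: invmx M.

Let MS (v : 'cV[R]_d) : M *m (S *m v) = g *: v.
Proof. by rewrite /S -scalemxAl -scalemxAr mulmxA mulmxV// mul1mx. Qed.

(** A lower bound [k] on the quadratic form of the shifted matrix is an upper
    bound [k^-1] on its inverse. *)
Let S_le k v : 0 < k ->
  k * dotv (S *m v) (S *m v) <= dotv (S *m v) (M *m (S *m v)) ->
  norm2 (S *m v) <= g / k * norm2 v.
Proof.
move=> k0; rewrite MS dotvZr -norm2_sqr => h.
have [S0|S0] := eqVneq (norm2 (S *m v)) 0.
  by rewrite S0 mulr_ge0 ?norm2_ge0// divr_ge0// ltW.
have n0 : 0 < norm2 (S *m v) by rewrite lt_neqAle eq_sym S0 norm2_ge0.
have : g * dotv (S *m v) v <= g * (norm2 (S *m v) * norm2 v).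
  by rewrite ler_pM2l// (le_trans (ler_norm _))// dotv_norm2.
move=> h'; rewrite mulrAC ler_pdivlMr// -(ler_pM2l n0); lra.
Qed.

Lemma shifted_inverse_step : normalized_step S u (g / (g + (l1 - l2))).
Proof.
have Ssym : S^T = S by rewrite /S linearZ /= trmx_inv Msym.
have Su : S *m u = u.
  have Mu : M *m u = g *: u by rewrite /M mulmxBl mul_scalar_mx Xu -scalerBl.
  by rewrite /S -scalemxAl scalemxAr -Mu mulmxA mulVmx// mul1mx.
split=> // v.
- rewrite -(pmulr_rge0 (dotv v (S *m v)) g0) -dotvZl -MS dotvC.
  by rewrite (le_trans _ (M_ge_norm _))// mulr_ge0 ?dotv_ge0// ltW.
- by rewrite -[leRHS]mul1r -(divff (lt0r_neq0 g0)) S_le.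
- move=> uv; apply: S_le; first by rewrite addr_gt0// subr_gt0.
  apply: le_trans (M_ge _).
  have -> : dotv u (S *m v) = 0 by rewrite -dotv_mull Ssym Su.
  by rewrite expr0n subr0 mulrDl.
Qed.

End ShiftedInverse.

(** * The repeat loop *)

Section AlgorithmAnalysis.
Variables (R : realType) (d : nat) (X : 'M[R]_d) (u : 'cV[R]_d).
Variables (A : oracle R d) (hdelta tol : R) (m1 : nat) (w0 : 'cV[R]_d).
Local Notation l1 := (lambda_ X 1).
Local Notation l2 := (lambda_ X 2).
Hypothesis Xsym : X^T = X.
Hypothesis u1 : dotv u u = 1.
Hypothesis Xu : X *m u = l1 *: u.
Hypothesis Xle : forall v, dotv v (X *m v) <=
  l1 * dotv u v ^+ 2 + l2 * (dotv v v - dotv u v ^+ 2).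
Hypothesis l21 : l2 < l1.
Hypothesis validA : valid_oracle X A.
Hypothesis tol0 : 0 < tol.
Hypothesis w01 : dotv w0 w0 = 1.

Definition step_matrix lam : 'M[R]_d := (lam - l1) *: invmx (lam%:M - X).

Lemma step_matrixP lam : l1 < lam ->
  normalized_step (step_matrix lam) u ((lam - l1) / (lam - l1 + (l1 - l2))).
Proof. by move=> ?; exact: shifted_inverse_step. Qed.

Lemma inverse_power_calls m lam k : (inverse_power A tol w0 m lam k).2 = (k + m)%N.
Proof.
elim: m => [|m IHm] /=; first by rewrite addn0.
by case: inverse_power IHm => w k' /= ->; rewrite addnS.
Qed.

(** In the scaling that makes the exact steps contractions, the errors of the
    oracle simply add up. *)
Lemma inverse_power_error m lam k : 0 < lam - l1 <= 1 ->
  norm2 ((lam - l1) ^+ m *: (inverse_power A tol w0 m lam k).1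
         - power (step_matrix lam) w0 m) <= m%:R * tol.
Proof.
move=> /andP[g0 g1]; set g := lam - l1 in g0 g1 *.
have l1lam : l1 < lam by rewrite -subr_gt0.
have St := step_matrixP l1lam.
elim: m => [|m IHm]; first by rewrite /= scale1r subrr norm20 mul0r.
rewrite /=; case: inverse_power IHm => w k' /= IHm.
set z := power _ _ _ in IHm *; set v := A _ _ _ _.
have -> : g ^+ m.+1 *: v - power (step_matrix lam) w0 m.+1 =
    g ^+ m.+1 *: (v - invmx (lam%:M - X) *m w) +
    step_matrix lam *m (g ^+ m *: w - z).
  rewrite mulmxBr -scalemxAr /step_matrix -/g -scalemxAl scalerA -exprSr.
  by rewrite scalerBr addrA subrK.
rewrite (le_trans (norm2D _ _))// -natr1 mulrDl mul1r addrC lerD//.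
  by rewrite (le_trans (step_le St _)).
rewrite norm2Z ger0_norm ?exprn_ge0 ?(ltW g0)//.
rewrite -[leRHS]mul1r ler_pM ?norm2_ge0 ?exprn_ge0 ?(ltW g0)//.
  by rewrite exprn_ile1// ltW.
exact: validA.
Qed.

Lemma normalize_scale (c : R) (v : 'cV[R]_d) : 0 < c ->
  normalize (c *: v) = normalize v.
Proof.
move=> c0; rewrite /normalize norm2Z gtr0_norm// scalerA invfM mulrAC mulVf ?mul1r//.
by rewrite gt_eqF.
Qed.

Lemma norm2_scale_gt0 (c : R) (v : 'cV[R]_d) : 0 < c ->
  0 < norm2 (c *: v) -> 0 < norm2 v.
Proof. by move=> c0; rewrite norm2Z gtr0_norm// pmulr_rgt0. Qed.

Hypothesis crude : (15 / 16) ^+ (2 * m1) < dotv u w0 ^+ 2.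
Hypothesis tol_m1 : m1%:R * tol <= `|dotv u w0| / 100.
Hypothesis tol_le : tol <= 1 / 16.

(** The Rayleigh quotient estimate turns into an estimate of the distance
    [lam - l1] of the shift to the leading eigenvalue, so that one pass
    shrinks this distance by a constant factor, from above and from below. *)
Lemma repeat_bodyP lam k : 0 < lam - l1 <= 1 ->
  exists2 Delta, repeat_body A m1 tol w0 lam k =
     (Delta, lam - Delta / 2, (k + m1.+1)%N) &
   (lam - l1) / 2 <= Delta <= 2 / 3 * (lam - l1).
Proof.
move=> g01; have /andP[g0 g1] := g01.
have l1lam : l1 < lam by rewrite -subr_gt0.
have St := step_matrixP l1lam.
have := inverse_power_error m1 k g01; have := inverse_power_calls m1 lam k.
rewrite /repeat_body; case: inverse_power => hw k1 /= -> err.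
set w := normalize hw; set v := A _ _ _ _.
have [hw0 ray] := crude_estimate St w01 crude (le_trans err tol_m1).
have c0 : 0 < (lam - l1) ^+ m1 by rewrite exprn_gt0.
rewrite normalize_scale// -/w in ray.
have nw : norm2 w = 1 by rewrite norm2_normalize// (norm2_scale_gt0 c0).
have hv : norm2 (v - invmx (lam%:M - X) *m w) <= tol by exact: validA.
set B := invmx _ in hv ray.
have : `|dotv w v - dotv w (B *m w)| <= tol.
  by rewrite -dotvBr (le_trans (dotv_norm2 _ _))// nw mul1r.
rewrite ler_norml => /andP[v1 v2].
set D := dotv w v - tol; set g := lam - l1 in g0 g1 *.
have ray' : 7 / 8 <= g * dotv w (B *m w) <= 1.
  by rewrite -dotvZr scalemxAl.
have /andP[r1 r2] := ray'; set y := dotv w (B *m w) in v1 v2 r1 r2.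
clearbody y.
have gt : g * tol <= tol by rewrite ler_piMl// ltW.
have D1 : g * D <= 1 by rewrite (le_trans _ r2)// ler_pM2l// /D; lra.
have D2 : 3 / 4 <= g * D.
  have : g * (y - 2 * tol) <= g * D by rewrite ler_pM2l// /D; lra.
  by have := tol_le; lra.
have D0 : 0 < D by rewrite -(pmulr_rgt0 _ g0); lra.
exists (2^-1 * D^-1); first by rewrite addnS.
have D'0 : 0 <= D^-1 by rewrite invr_ge0 ltW.
have h1 : g * D * D^-1 <= 1 * D^-1 by rewrite ler_wpM2r.
have h2 : 3 / 4 * D^-1 <= g * D * D^-1 by rewrite ler_wpM2r.
by rewrite mulfK ?gt_eqF// in h1 h2; apply/andP; split; lra.
Qed.

(** The loop is left as soon as [lam - l1] has dropped to the order of
    [hdelta]: a pass entered with [lam - l1 <= 3 / 2 * hdelta] is the last. *)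
Lemma repeat_loop_terminates n lam k : 0 < lam - l1 <= 1 ->
  lam - l1 <= (4 / 3) ^+ n * (3 / 2 * hdelta) ->
  exists lamf kf, [/\ repeat_loop A hdelta m1 tol w0 lam k lamf kf,
    0 < lamf - l1 <= 1, lamf - l1 <= 3 / 2 * hdelta &
    (kf <= k + n.+1 * m1.+1)%N].
Proof.
elim: n lam k => [|n IHn] lam k g01 gn.
  have [Delta body /andP[D1 D2]] := repeat_bodyP k g01.
  rewrite mul1r in gn.
  exists (lam - Delta / 2), (k + m1.+1)%N; split.
  - by apply: RepeatStop body _; lra.
  - by move: g01 => /andP[]; lra.
  - by lra.
  - by rewrite mul1n.
have [Delta body /andP[D1 D2]] := repeat_bodyP k g01.
have [Dle|Dgt] := leP Delta hdelta.
  exists (lam - Delta / 2), (k + m1.+1)%N; split.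
  - exact: RepeatStop body _.
  - by move: g01 => /andP[]; lra.
  - by lra.
  - by rewrite leq_add2l leq_pmull.
have [||lamf [kf [loop g1 g2 kf_le]]] := IHn (lam - Delta / 2) (k + m1.+1)%N.
- by move: g01 => /andP[]; lra.
- by move: gn; rewrite exprS; lra.
exists lamf, kf; split=> //.
  exact: RepeatAgain body Dgt loop.
by rewrite (leq_trans kf_le)// -addnA leq_add2l [leqRHS]mulSn.
Qed.

End AlgorithmAnalysis.

(** * Iteration counts and constants *)

Section Numerics.
Variable R : realType.
Implicit Types (a c h k p eps delta x y A tol : R) (d m n : nat).

Lemma ceil_ln_le k A m : 0 < k -> 0 < A -> Num.ceil (k * ln A) <= m%:Z ->
  expR (- (m%:R / k)) <= A^-1.
Proof.
move=> k0 A0; rewrite ceil_le_int => kA.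
rewrite expRN lef_pV2 ?posrE ?expR_gt0// -{1}(lnK A0) ler_expR.
by rewrite ler_pdivlMr// mulrC.
Qed.

Lemma ceil_ln_ge k A m : m%:Z = Num.ceil (k * ln A) -> m%:R <= k * ln A + 1.
Proof.
move=> mE; have := ceilB1_lt (k * ln A).
by rewrite -mE intrB ltrBlDr => /ltW.
Qed.

(** [T_crude d (1 / 8) p] makes [expR (- m / 8)] at most [p ^+ 2 / (144 * d)],
    and [15 / 16 <= expR (- 1 / 16)]. *)
Lemma crude_count d p m a : (0 < d)%N -> 0 < p -> T_crude d (1 / 8) p <= m%:Z ->
  p ^+ 2 / (9 * d%:R) <= a ^+ 2 -> (15 / 16) ^+ (2 * m) < a ^+ 2.
Proof.
move=> d0 p0 Tm; apply: lt_le_trans.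
have d0' : 0 < d%:R :> R by rewrite ltr0n.
have A0 : 0 < 18 * d%:R / (p ^+ 2 * (1 / 8)).
  by rewrite divr_gt0 ?mulr_gt0 ?exprn_gt0//; lra.
have := ceil_ln_le _ A0 Tm; rewrite invr_gt0 => /(_ _)/le_lt_trans-h.
apply: (@le_lt_trans _ _ (expR (- (m%:R / (1 / 8)^-1)))).
  have -> : - (m%:R / (1 / 8)^-1) = (2 * m)%:R * (- (1 / 16)) :> R.
    by rewrite natrM; field.
  rewrite expRM_natl lerXn2r ?nnegrE ?expR_ge0//.
  by apply: le_trans (expR_ge1Dx _); lra.
apply: h; first lra.
have -> : (18 * d%:R / (p ^+ 2 * (1 / 8)))^-1 = (p ^+ 2 / d%:R) / 144.
  by field; rewrite !gt_eqF.
have -> : p ^+ 2 / (9 * d%:R) = (p ^+ 2 / d%:R) / 9 by field; rewrite gt_eqF.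
have : 0 < p ^+ 2 / d%:R by rewrite divr_gt0// exprn_gt0.
lra.
Qed.

(** [T_acc d 3 (eps / 2) p] makes [expR (- 2 * m / 3)] at most
    [p ^+ 2 * (eps / 2) / (9 * d)], and [1 / 3 <= expR (- 2 / 3)]. *)
Lemma accurate_count d p eps m a : (0 < d)%N -> 0 < p -> 0 < eps ->
  T_acc d 3 (eps / 2) p <= m%:Z ->
  p ^+ 2 / (9 * d%:R) <= a ^+ 2 -> (1 / 3) ^+ m <= a ^+ 2 * (eps / 2).
Proof.
move=> d0 p0 eps0 Tm pa.
have d0' : 0 < d%:R :> R by rewrite ltr0n.
have A0 : 0 < 9 * d%:R / (p ^+ 2 * (eps / 2)).
  by rewrite divr_gt0 ?mulr_gt0 ?exprn_gt0//; lra.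
have := ceil_ln_le _ A0 Tm => /(_ _)/le_trans-h.
apply: (@le_trans _ _ (expR (- (m%:R / (3 / 2))))).
  have -> : - (m%:R / (3 / 2)) = m%:R * (- (2 / 3)) :> R by field.
  rewrite expRM_natl lerXn2r ?nnegrE ?expR_ge0//.
  by apply: le_trans (expR_ge1Dx _); lra.
apply: h; first lra.
have -> : (9 * d%:R / (p ^+ 2 * (eps / 2)))^-1 = p ^+ 2 / (9 * d%:R) * (eps / 2).
  by field; rewrite !gt_eqF.
by rewrite ler_wpM2r//; lra.
Qed.

(** The accumulated oracle errors are negligible: the factor [(h / 8) ^+ m]
    outweighs both the number [m] of steps and the smallness of the overlap. *)
Lemma noise_le c h m a tol : 0 <= c -> 0 < h <= 1 -> 0 <= a ->
  (1 / 4) ^+ m <= a ^+ 2 -> tol <= c * (h / 8) ^+ m.+1 ->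
  m%:R * tol <= c / 8 * a.
Proof.
move=> c0 /andP[h0 h1] a0 ma tol_le.
have am : (1 / 2) ^+ m <= a.
  rewrite -(@ler_pXn2r _ 2) ?nnegrE ?exprn_ge0//.
  rewrite -exprM mulnC exprM; apply: le_trans ma.
  by have -> : (1 / 2) ^+ 2 = 1 / 4 :> R by field.
have m2 : m%:R <= 2 ^+ m :> R by rewrite -natrX ler_nat ltnW// ltn_expl.
apply: (@le_trans _ _ (2 ^+ m * (c * (1 / 8) ^+ m.+1))).
  apply: (@le_trans _ _ (m%:R * (c * (1 / 8) ^+ m.+1))).
    rewrite ler_wpM2l// (le_trans tol_le)// ler_wpM2l//.
    by rewrite lerXn2r ?nnegrE//; lra.
  by rewrite ler_wpM2r// mulr_ge0// exprn_ge0//; lra.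
have -> : 2 ^+ m * (c * (1 / 8) ^+ m.+1) = c / 8 * (2 * (1 / 8)) ^+ m.
  by rewrite exprS [(2 * (1 / 8)) ^+ m]exprMn; field.
rewrite ler_wpM2l//; first lra.
by apply: le_trans am; rewrite lerXn2r ?nnegrE//; lra.
Qed.

Lemma ln_ge_half x : 2 <= x -> 1 / 2 <= ln x.
Proof.
move=> x2; have x0 : 0 < x by lra.
have := expR_ge1Dx (- ln x); rewrite expRN lnK ?posrE//.
have : x^-1 <= 2^-1 by rewrite lef_pV2 ?posrE.
lra.
Qed.

(** The logarithms in the iteration counts are those of quantities at most
    quadratic in [y], and the constant 144 is absorbed by [2 ^+ 8 <= y ^+ 8]. *)
Lemma ln_le_10 A y : 2 <= y -> 0 < A -> A <= 144 * y ^+ 2 -> ln A <= 10 * ln y.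
Proof.
move=> y2 A0 Ay; have y0 : 0 < y by lra.
rewrite mulr_natl -lnXn// ler_ln ?posrE ?exprn_gt0//.
apply: (le_trans Ay); rewrite (exprD y 8 2) ler_wpM2r ?sqr_ge0//.
apply: (@le_trans _ _ (2 ^+ 8)); first by rewrite -natrX ler_nat.
by rewrite lerXn2r ?nnegrE// ltW.
Qed.

(** Enough passes of the loop for the distance of the shift to the leading
    eigenvalue to drop from 1 to the order of the eigengap. *)
Lemma pass_count delta : 0 < delta <= 1 ->
  exists n, n%:R <= 4 * ln delta^-1 + 2 /\ 1 <= (4 / 3) ^+ n * (3 / 4 * delta).
Proof.
move=> /andP[d0 d1].
have L0 : 0 <= ln delta^-1 by rewrite ln_ge0// invf_ge1.
pose k := Num.trunc (4 * ln delta^-1).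
have L40 : 0 <= 4 * ln delta^-1 by rewrite mulr_ge0.
have /andP[k1 k2] := truncn_itv L40.
exists k.+2; split; first by rewrite -addn2 natrD lerD2r.
have -> : (4 / 3) ^+ k.+2 * (3 / 4 * delta) = (4 / 3) ^+ k.+1 * delta.
  by rewrite exprS; move: (_ ^+ k.+1) => x; field.
rewrite -ler_pdivrMr// div1r -(@lnK _ delta^-1) ?posrE ?invr_gt0//.
apply: (@le_trans _ _ (expR (k.+1%:R * (1 / 4)))).
  by rewrite ler_expR; move: k2; rewrite -/k; lra.
rewrite expRM_natl lerXn2r ?nnegrE ?expR_ge0//.
have -> : 4 / 3 = (3 / 4)^-1 :> R by field.
rewrite -[X in expR X]opprK expRN lef_pV2 ?posrE ?expR_gt0//.
by apply: le_trans (expR_ge1Dx _); lra.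
Qed.

(** Each pass makes [m1 + 1] calls, and [m1] is of order [ln (d / p)].  The
    passes that are not charged to [ln delta^-1] are constant in number; their
    calls are absorbed by the term [ln (d / (p * eps))], which is at least
    [ln (d / p)].  The constants come from [1 <= 2 * ln (d / p)]. *)
Lemma call_count d p eps delta m1 m2 n kf :
  (2 <= d)%N -> 0 < p <= 1 -> 0 < eps < 1 -> 0 < delta <= 1 ->
  n%:R <= 4 * ln delta^-1 + 2 -> (kf <= n.+1 * m1.+1)%N ->
  m1%:Z = T_crude d (1 / 8) p -> m2%:Z = T_acc d 3 (eps / 2) p ->
  (kf + m2)%:R <= 336 * (ln (d%:R / p) * ln delta^-1 + ln (d%:R / (p * eps))).
Proof.
move=> d2 /andP[p0 p1] /andP[e0 e1] /andP[de0 de1] nle kfle m1E m2E.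
have d2' : 2 <= d%:R :> R by rewrite ler_nat.
have d0 : 0 < d%:R :> R by lra.
set L := ln delta^-1 in nle *; have L0 : 0 <= L by rewrite ln_ge0// invf_ge1.
set y := d%:R / p; set y' := d%:R / (p * eps).
have y2 : 2 <= y by rewrite ler_pdivlMr//; nra.
have y0 : 0 < y by lra.
have y'E : y' = y / eps by rewrite /y' /y; field; rewrite !gt_eqF.
have yy' : y <= y' by rewrite y'E ler_pdivlMr// ler_piMr// ltW.
have y'2 : 2 <= y' by lra.
have l_l' : ln y <= ln y' by rewrite ler_ln ?posrE//; lra.
have hl := ln_ge_half y2.
have m1_le : m1%:R + 1 <= 84 * ln y.
  have := ceil_ln_ge m1E.
  have /(ln_le_10 y2) : 0 < 18 * d%:R / (p ^+ 2 * (1 / 8)).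
    by rewrite divr_gt0 ?mulr_gt0 ?exprn_gt0//; lra.
  have -> : 18 * d%:R / (p ^+ 2 * (1 / 8)) = 144 * (d%:R / p ^+ 2).
    by field; rewrite gt_eqF.
  have -> : y ^+ 2 = d%:R * (d%:R / p ^+ 2) by rewrite /y; field; rewrite gt_eqF.
  rewrite ler_pM2l// ler_peMl ?divr_ge0 ?exprn_ge0 ?(ltW p0) ?(ltW d0)//; last lra.
  move=> /(_ isT); have -> : (1 / 8)^-1 = 8 :> R by field.
  lra.
have m2_le : m2%:R <= 17 * ln y'.
  have := ceil_ln_ge m2E.
  have /(ln_le_10 y'2) : 0 < 9 * d%:R / (p ^+ 2 * (eps / 2)).
    by rewrite divr_gt0 ?mulr_gt0 ?exprn_gt0//; lra.
  have -> : 9 * d%:R / (p ^+ 2 * (eps / 2)) = 18 * (d%:R / (p ^+ 2 * eps)).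
    by field; rewrite !gt_eqF.
  have -> : y' ^+ 2 = (d%:R / eps) * (d%:R / (p ^+ 2 * eps)).
    by rewrite /y'; field; rewrite !gt_eqF.
  set z := d%:R / (p ^+ 2 * eps).
  have z0 : 0 < z by rewrite divr_gt0// mulr_gt0// exprn_gt0.
  have : 1 <= d%:R / eps by rewrite ler_pdivlMr//; lra.
  rewrite -(ler_pM2r z0) => hz /(_ _)-h h'.
  have : 18 * z <= 144 * (d%:R / eps * z) by lra.
  by move=> /h; lra.
have kf_le : kf%:R <= (4 * L + 3) * (84 * ln y).
  apply: (@le_trans _ _ (n.+1%:R * m1.+1%:R)); first by rewrite -natrM ler_nat.
  by rewrite ler_pM// -natr1//; lra.
rewrite natrD; have : 0 <= ln y * L by rewrite mulr_ge0//; lra.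
lra.
Qed.

End Numerics.

(** * Correctness *)

(** The random start vector matters only through its overlap with the leading
    eigenvector; once this is not too small, the rest of the argument is
    deterministic and allows an adversarial oracle. *)
Lemma algorithm_correct (R : realType) (d : nat) (X : 'M[R]_d) (u w0 : 'cV[R]_d)
    (A : oracle R d) (hdelta eps p tol : R) (m1 m2 : nat) :
  let delta := eigengap X in
  (2 <= d)%N -> X^T = X -> psd X -> lambda_ X 1 <= 1 -> 0 < delta ->
  unit_leading_eigenvector X u -> delta / 2 <= hdelta <= 3 * delta / 4 ->
  0 < eps < 1 -> 0 < p <= 1 ->
  T_crude d (1 / 8) p <= m1%:Z -> T_acc d 3 (eps / 2) p <= m2%:Z ->
  0 < tol -> tol <= 1 / 16 * (hdelta / 8) ^+ m1.+1 ->
  tol <= eps / 4 * (hdelta / 8) ^+ m2.+1 ->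
  valid_oracle X A -> norm2 w0 = 1 ->
  p ^+ 2 / (9 * d%:R) <= dotv u w0 ^+ 2 ->
  exists (wf : 'cV[R]_d) (N : nat),
    [/\ algorithm_returns A hdelta m1 m2 tol w0 wf N,
        norm2 wf = 1, 1 - eps <= dotv wf u ^+ 2 &
        m1%:Z = T_crude d (1 / 8) p -> m2%:Z = T_acc d 3 (eps / 2) p ->
        N%:R <= 336 * (ln (d%:R / p) * ln delta^-1 + ln (d%:R / (p * eps)))].
Proof.
move=> delta d2 Xsym Xpsd l1_le1 delta0 ulead hd eps01 p01 Tm1 Tm2 tol0.
move=> tol1 tol2 validA nw0 overlap.
have [u1 Xu l20 Xle] := leading_eigenpair d2 Xsym Xpsd delta0 ulead.
have w01 : dotv w0 w0 = 1 by rewrite -norm2_sqr nw0 expr1n.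
have l21 : lambda_ X 2 < lambda_ X 1 by rewrite -subr_gt0.
have deltaE : delta = lambda_ X 1 - lambda_ X 2 by [].
have /andP[p0 p1] := p01; have /andP[eps0 eps1] := eps01.
have /andP[hd1 hd2] := hd.
have d0 : (0 < d)%N by exact: ltnW.
have h01 : 0 < hdelta <= 1 by lra.
have crude := crude_count d0 p0 Tm1 overlap.
have acc := accurate_count d0 p0 eps0 Tm2 overlap.
set a := `|dotv u w0|.
have a0 : 0 <= a by exact: normr_ge0.
have aa : dotv u w0 ^+ 2 = a ^+ 2 by rewrite real_normK ?num_real.
have noise1 : m1%:R * tol <= a / 100.
  have c16 : 0 <= 1 / 16 :> R by lra.
  have h4 : (1 / 4) ^+ m1 <= a ^+ 2.
    rewrite -aa (le_trans _ (ltW crude))// exprM lerXn2r ?nnegrE ?exprn_ge0//.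
    lra.
  have := noise_le c16 h01 a0 h4 tol1; lra.
have noise2 : m2%:R * tol <= a * (eps / 32).
  have q0 : 0 <= eps / 4 :> R by lra.
  have h4 : (1 / 4) ^+ m2 <= a ^+ 2.
    apply: (@le_trans _ _ ((1 / 3) ^+ m2)).
      by rewrite lerXn2r ?nnegrE//; lra.
    by rewrite -aa (le_trans acc)// ler_piMr ?sqr_ge0//; lra.
  have := noise_le q0 h01 a0 h4 tol2; lra.
have tol16 : tol <= 1 / 16.
  rewrite (le_trans tol1)// ler_piMr//.
  by rewrite exprn_ile1//; lra.
have delta1 : 0 < delta <= 1 by lra.
have [n [n_le n_ge]] := pass_count delta1.
have g01 : 0 < 1 + hdelta - lambda_ X 1 <= 1 by lra.
have gn : 1 + hdelta - lambda_ X 1 <= (4 / 3) ^+ n * (3 / 2 * hdelta).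
  apply: (@le_trans _ _ 1); first by lra.
  apply: (le_trans n_ge); rewrite ler_wpM2l ?exprn_ge0//; lra.
have [lamf [kf [loop g1 g2 kf_le]]] :=
  repeat_loop_terminates Xsym u1 Xu Xle l21 validA tol0 w01 crude noise1 tol16
    0%N g01 gn.
have l1f : lambda_ X 1 < lamf by rewrite -subr_gt0; case/andP: g1.
have St := step_matrixP Xsym u1 Xu Xle l21 l1f.
set q := _ / _ in St; set g := lamf - _ in g1 g2 q St.
have /andP[gp gl] := g1.
have gd0 : 0 < g + (lambda_ X 1 - lambda_ X 2) by lra.
have q0 : 0 <= q by rewrite divr_ge0// ltW.
(* [g <= 9 / 8 * delta], as [hdelta <= 3 / 4 * delta]. *)
have q_le : q <= 9 / 17 by rewrite ler_pdivrMr//; lra.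
have qm : (q ^+ m2) ^+ 2 <= dotv u w0 ^+ 2 * (eps / 2).
  apply: le_trans acc; rewrite -exprM mulnC exprM lerXn2r ?nnegrE ?sqr_ge0//.
  apply: (@le_trans _ _ ((9 / 17) ^+ 2)); last lra.
  by rewrite lerXn2r ?nnegrE//; lra.
have := inverse_power_error w0 Xsym u1 Xu Xle l21 validA tol0 m2 kf g1.
have := inverse_power_calls A tol w0 m2 lamf kf.
case hwE : (inverse_power A tol w0 m2 lamf kf) => [hw N] /= NE err.
have a_neq0 : dotv u w0 != 0.
  apply: contraTneq crude => ->; rewrite expr0n -leNgt exprn_ge0//; lra.
have [hw0 hacc] := accurate_estimate St q0 w01 eps01 a_neq0 qm (le_trans err noise2).
have c0 : 0 < g ^+ m2 by rewrite exprn_gt0.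
rewrite normalize_scale// in hacc.
exists (normalize hw), N; split=> //.
- by exists lamf, kf; split=> //; exists hw.
- by rewrite norm2_normalize// (norm2_scale_gt0 c0).
- move=> m1E m2E; rewrite NE.
  exact: (call_count d2 p01 eps01 delta1 n_le kf_le m1E m2E).
Qed.

Theorem theorem4p2 (R : realType) :
  exists C : R, 0 < C /\
  forall (d : nat) (X : 'M[R]_d) (u1 : 'cV[R]_d) (hdelta eps p tol : R)
         (m1 m2 : nat)
         (d0 : measure_display) (Omega : measurableType d0)
         (P : probability Omega R)
         (W0 : Omega -> 'cV[R]_d) (A : Omega -> oracle R d),
  let delta := eigengap X in
  (2 <= d)%N ->
  X^T = X -> psd X -> lambda_ X 1 <= 1 -> 0 < delta ->
  unit_leading_eigenvector X u1 ->
  delta / 2 <= hdelta <= 3 * delta / 4 ->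
  0 < eps < 1 -> 0 < p ->
  T_crude d (1 / 8) p <= m1%:Z ->
  T_acc d 3 (eps / 2) p <= m2%:Z ->
  0 < tol ->
  tol <= Num.min (1 / 16 * (hdelta / 8) ^+ m1.+1)
                 (eps / 4 * (hdelta / 8) ^+ m2.+1) ->
  uniform_unit_vector P W0 ->
  (forall omega, valid_oracle X (A omega)) ->
  exists E : set Omega,
    [/\ measurable E, ((1 - p)%:E <= P E)%E &
    forall omega, E omega ->
      exists (wf : 'cV[R]_d) (N : nat),
        [/\ algorithm_returns (A omega) hdelta m1 m2 tol (W0 omega) wf N,
            norm2 wf = 1,
            1 - eps <= dotv wf u1 ^+ 2 &
            m1%:Z = T_crude d (1 / 8) p ->
            m2%:Z = T_acc d 3 (eps / 2) p ->
            N%:R <= C * (ln (d%:R / p) * ln delta^-1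
                         + ln (d%:R / (p * eps)))]].
Proof.
exists 336; split=> //.
move=> d X u1 hdelta eps p tol m1 m2 d0 Omega P W0 A delta d2 Xsym Xpsd l1_le1.
move=> delta0 ulead hd eps01 p0 Tm1 Tm2 tol0; rewrite le_min => /andP[tol1 tol2].
move=> unifW validA.
have [p1|p1] := leP 1 p.
  exists set0; split=> //.
  by rewrite measure0 lee_fin subr_le0.
have p01 : 0 < p < 1 by rewrite p0.
have u11 : dotv u1 u1 = 1 by rewrite -norm2_sqr (proj1 ulead) expr1n.
pose r : R := Num.sqrt d%:R.
have d0' : 0 < d%:R :> R by rewrite ltr0n ltnW.
have r0 : 0 < r by rewrite sqrtr_gt0.
have rr : r ^+ 2 = d%:R by rewrite sqr_sqrtr// ltW.
pose B := [set w | `|dotv u1 (W0 w)| < p / (3 * r)].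
have [mB PB] : measurable B /\ fine (P B) <= p.
  rewrite /B /r.
  clear -unifW d2 p01 u11.
  case: d d2 W0 u1 unifW u11 => [//|n] n0 W u unifW u11.
  split; last exact: sphere_anticoncentration.
  have mabs : measurable [set x : R | `|x| < p / (3 * Num.sqrt n.+1%:R)].
    exact: measurable_abs_lt.
  rewrite -[X in measurable X]setTI.
  exact: (measurable_coordinate unifW u measurableT mabs).
exists (~` B); split.
- exact: measurableC.
- rewrite probability_setC// -(@fineK _ (P B)) ?fin_num_measure//.
  by rewrite -EFinB lee_fin lerB.
move=> w /negP; rewrite -leNgt => Bw.
have p01' : 0 < p <= 1 by rewrite p0 ltW.
have [_ nW _] := unifW.
apply: (algorithm_correct d2 Xsym Xpsd l1_le1 delta0 ulead hd eps01 p01' Tm1 Tm2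
  tol0 tol1 tol2 (validA w) (nW w)).
rewrite -[leRHS]real_normK ?num_real//.
have -> : p ^+ 2 / (9 * d%:R) = (p / (3 * r)) ^+ 2.
  by rewrite -rr; field; rewrite gt_eqF.
by rewrite ler_sqr// nnegrE divr_ge0 ?mulr_ge0 ?(ltW r0) ?(ltW p0).
Qed.
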